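(* Over the base system $\mathsf{RCA}_0$, the following are equivalent: (1) $\mathsf{ACA}_0$; (2) a countable connected interval graph $(V,E)$ is uniquely orderable if and only if it does not contain a buried subgraph.
   Context: This is a statement of reverse mathematics in second order arithmetic; $\mathsf{RCA}_0$ and $\mathsf{ACA}_0$ are the standard subsystems (recursive comprehension and arithmetical comprehension). Countable graphs are coded by sets $V\subseteq\mathbb{N}$ and symmetric $E\subseteq V\times V$. A graph $(V,E)$ is an interval graph if there exist a linear order $(L,<_L)$ and a relation $F\subseteq V\times L$ such that, writing $F(p)=\{x\in L\mid (p,x)\in F\}$, for all $p,q\in V$: $F(p)\neq\emptyset$, $F(p)$ is convex in $L$ (if $x,y\in F(p)$ and $x<_L z<_L y$ then $z\in F(p)$), and $p\,E\,q\iff F(p)\cap F(q)\neq\emptyset$. A strict partial order $\prec$ on $V$ is associated to $(V,E)$ if for all $u,v$: $\neg\,u\,E\,v$ iff ($u\prec v$ or $v\prec u$); $(V,E)$ is uniquely orderable if there is such an associated order and the only other associated order is its dual. For $B\subseteq V$ let $K(B)=\{v\in V\mid \forall b\in B\,(v\,E\,b)\}$ and $R(B)=V\setminus(B\cup K(B))$; $B$ is a buried subgraph if (i) there are $a,b\in B$ with $\neg\,a\,E\,b$; (ii) $K(B)\cap B=\emptyset$ and $R(B)\neq\emptyset$; (iii) $\neg\,b\,E\,r$ for all $b\in B$, $r\in R(B)$. Connected means any two vertices are joined by a finite path. *)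

(* Defs.v *)
(** * Subsystems of second order arithmetic and unique orderability

    Systems are treated through their general (Henkin) models: the first order
    part may be nonstandard and the set quantifiers range over the second order
    part of the structure only. *)

Set Implicit Arguments.
Unset Strict Implicit.
Unset Printing Implicit Defensive.

(** ** L2-structures *)

(* Equality of sets is not primitive in L2, so extensionality of [mem] is not
   required; two sets are identified when they have the same elements. *)
Record l2_structure : Type := L2Structure {
  num : Type;
  sets : Type;
  zero : num;
  one : num;
  add : num -> num -> num;
  mul : num -> num -> num;
  lt : num -> num -> Prop;
  mem : num -> sets -> Prop;
  sets_inhabited : inhabited sets
}.

Arguments zero {_}.
Arguments one {_}.
Arguments add {_} _ _.
Arguments mul {_} _ _.
Arguments lt {_} _ _.
Arguments mem {_} _ _.

Declare Scope l2_scope.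
Delimit Scope l2_scope with l2.
Notation "0" := zero : l2_scope.
Notation "1" := one : l2_scope.
Notation "x + y" := (add x y) : l2_scope.
Notation "x * y" := (mul x y) : l2_scope.
Notation "x < y" := (lt x y) : l2_scope.
Notation "x ∈ X" := (mem x X) (at level 70, no associativity) : l2_scope.

(** ** Formulas of L2 *)

(* De Bruijn indices, numbered separately for number and set variables. *)
Inductive term : Type :=
  | tVar (n : nat)
  | tZero
  | tOne
  | tAdd (t u : term)
  | tMul (t u : term).

Inductive formula : Type :=
  | fEq (t u : term)
  | fLt (t u : term)
  | fMem (t : term) (X : nat)
  | fNot (p : formula)
  | fAnd (p q : formula)
  | fOr (p q : formula)
  | fImp (p q : formula)
  | fAll (p : formula)
  | fEx (p : formula)
  | fAllSet (p : formula)
  | fExSet (p : formula).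

Definition scons (A : Type) (a : A) (e : nat -> A) (n : nat) : A :=
  match n with O => a | S k => e k end.

Fixpoint eval (M : l2_structure) (e : nat -> num M) (t : term) : num M :=
  match t with
  | tVar n => e n
  | tZero => zero
  | tOne => one
  | tAdd t u => add (eval e t) (eval e u)
  | tMul t u => mul (eval e t) (eval e u)
  end.

Fixpoint sat (M : l2_structure) (e : nat -> num M) (s : nat -> sets M)
    (p : formula) : Prop :=
  match p with
  | fEq t u => eval e t = eval e u
  | fLt t u => lt (eval e t) (eval e u)
  | fMem t X => mem (eval e t) (s X)
  | fNot p => ~ sat e s p
  | fAnd p q => sat e s p /\ sat e s q
  | fOr p q => sat e s p \/ sat e s q
  | fImp p q => sat e s p -> sat e s q
  | fAll p => forall a : num M, sat (scons a e) s p
  | fEx p => exists a : num M, sat (scons a e) s p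
  | fAllSet p => forall X : sets M, sat e (scons X s) p
  | fExSet p => exists X : sets M, sat e (scons X s) p
  end.

Fixpoint lift (t : term) : term :=
  match t with
  | tVar n => tVar (S n)
  | tZero => tZero
  | tOne => tOne
  | tAdd t u => tAdd (lift t) (lift u)
  | tMul t u => tMul (lift t) (lift u)
  end.

(* The bounding term is lifted because the bound variable may not occur
   in it. *)
Definition fAllLt (t : term) (p : formula) : formula :=
  fAll (fImp (fLt (tVar 0) (lift t)) p).
Definition fExLt (t : term) (p : formula) : formula :=
  fEx (fAnd (fLt (tVar 0) (lift t)) p).

Inductive bounded : formula -> Prop :=
  | bounded_eq t u : bounded (fEq t u)
  | bounded_lt t u : bounded (fLt t u)
  | bounded_mem t X : bounded (fMem t X)
  | bounded_not p : bounded p -> bounded (fNot p)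
  | bounded_and p q : bounded p -> bounded q -> bounded (fAnd p q)
  | bounded_or p q : bounded p -> bounded q -> bounded (fOr p q)
  | bounded_imp p q : bounded p -> bounded q -> bounded (fImp p q)
  | bounded_all t p : bounded p -> bounded (fAllLt t p)
  | bounded_ex t p : bounded p -> bounded (fExLt t p).

Inductive Sigma01 : formula -> Prop :=
  | Sigma01_ex p : bounded p -> Sigma01 (fEx p).

Inductive Pi01 : formula -> Prop :=
  | Pi01_all p : bounded p -> Pi01 (fAll p).

Fixpoint arithmetical (p : formula) : Prop :=
  match p with
  | fEq _ _ | fLt _ _ | fMem _ _ => True
  | fNot p | fAll p | fEx p => arithmetical p
  | fAnd p q | fOr p q | fImp p q => arithmetical p /\ arithmetical q
  | fAllSet _ | fExSet _ => False
  end.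

(** ** The systems RCA0 and ACA0 *)

Section Systems.
Local Open Scope l2_scope.
Variable M : l2_structure.

Record basic_axioms : Prop := BasicLaws {
  succ_neq0 : forall n : num M, n + 1 <> 0;
  succ_inj : forall m n : num M, m + 1 = n + 1 -> m = n;
  add_0 : forall m : num M, m + 0 = m;
  add_succ : forall m n : num M, m + (n + 1) = (m + n) + 1;
  mul_0 : forall m : num M, m * 0 = 0;
  mul_succ : forall m n : num M, m * (n + 1) = (m * n) + m;
  not_lt_0 : forall m : num M, ~ m < 0;
  lt_succ : forall m n : num M, m < n + 1 <-> m < n \/ m = n
}.

(* In the schemes below the distinguished number variable of a formula has
   index 0. The remaining variables are parameters, interpreted by [e] and [s];
   in particular the set asserted to exist by comprehension is not among
   them. *)

Definition Sigma01_induction : Prop :=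
  forall (p : formula) (e : nat -> num M) (s : nat -> sets M),
    Sigma01 p ->
    sat (scons 0 e) s p ->
    (forall n, sat (scons n e) s p -> sat (scons (n + 1) e) s p) ->
    forall n, sat (scons n e) s p.

Definition Delta01_comprehension : Prop :=
  forall (p q : formula) (e : nat -> num M) (s : nat -> sets M),
    Sigma01 p -> Pi01 q ->
    (forall n, sat (scons n e) s p <-> sat (scons n e) s q) ->
    exists X : sets M, forall n, n ∈ X <-> sat (scons n e) s p.

Definition set_induction : Prop :=
  forall X : sets M,
    0 ∈ X -> (forall n, n ∈ X -> n + 1 ∈ X) -> forall n, n ∈ X.

Definition arithmetical_comprehension : Prop :=
  forall (p : formula) (e : nat -> num M) (s : nat -> sets M),
    arithmetical p ->
    exists X : sets M, forall n, n ∈ X <-> sat (scons n e) s p.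

Definition models_RCA0 : Prop :=
  basic_axioms /\ Sigma01_induction /\ Delta01_comprehension.

Definition models_ACA0 : Prop :=
  basic_axioms /\ set_induction /\ arithmetical_comprehension.

End Systems.

(** ** Graphs inside a structure

    All quantifiers below range over [num M] and [sets M], so each definition is
    the interpretation in [M] of an L2-formula. *)

Section Graphs.
Local Open Scope l2_scope.
Variable M : l2_structure.
Implicit Types (V E L P Q F B R X : sets M).

Definition pair (i j : num M) : num M := (i + j) * (i + j) + i.

Definition holds R (x y : num M) : Prop := pair x y ∈ R.

Definition sub_prod R (A B : sets M) : Prop :=
  forall z, z ∈ R -> exists x y, x ∈ A /\ y ∈ B /\ z = pair x y.

Definition graph V E : Prop :=
  sub_prod E V V /\ (forall u v, holds E u v -> holds E v u).

Definition strict_partial_order V P : Prop :=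
  sub_prod P V V /\
  (forall x, ~ holds P x x) /\
  (forall x y z, holds P x y -> holds P y z -> holds P x z).

Definition linear_order L R : Prop :=
  strict_partial_order L R /\
  (forall x y, x ∈ L -> y ∈ L -> holds R x y \/ x = y \/ holds R y x).

(* A finite sequence of length [l] is a finite (that is, bounded) set of pairs
   which is a function with domain the numbers below [l]. *)
Definition finite_sequence X (l : num M) : Prop :=
  (exists k, forall z, z ∈ X -> z < k) /\
  (forall z, z ∈ X -> exists i x, z = pair i x) /\
  (forall i x y, holds X i x -> holds X i y -> x = y) /\
  (forall i, i < l <-> exists x, holds X i x).

Definition path V E X (n u v : num M) : Prop :=
  finite_sequence X (n + 1) /\
  (forall i x, holds X i x -> x ∈ V) /\
  holds X 0 u /\ holds X n v /\
  (forall i x y, i < n -> holds X i x -> holds X (i + 1) y -> holds E x y).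

Definition connected V E : Prop :=
  forall u v, u ∈ V -> v ∈ V -> exists X n, path V E X n u v.

Definition interval_representation V E L R F : Prop :=
  linear_order L R /\ sub_prod F V L /\
  (forall p, p ∈ V -> exists x, holds F p x) /\
  (forall p x y z, p ∈ V -> holds F p x -> holds F p y -> z ∈ L ->
     holds R x z -> holds R z y -> holds F p z) /\
  (forall p q, p ∈ V -> q ∈ V ->
     (holds E p q <-> exists x, holds F p x /\ holds F q x)).

Definition interval_graph V E : Prop :=
  graph V E /\ exists L R F, interval_representation V E L R F.

Definition associated_order V E P : Prop :=
  strict_partial_order V P /\
  (forall u v, u ∈ V -> v ∈ V ->
     (~ holds E u v <-> holds P u v \/ holds P v u)).

Definition same_order P Q : Prop := forall x y, holds Q x y <-> holds P x y.
Definition dual_order P Q : Prop := forall x y, holds Q x y <-> holds P y x.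

(* For a complete graph the only associated order is empty, hence its own
   dual; such a graph is uniquely orderable. *)
Definition uniquely_orderable V E : Prop :=
  exists P, associated_order V E P /\
    forall Q, associated_order V E Q -> same_order P Q \/ dual_order P Q.

(* [inK V E B] and [inR V E B] are classes: K(B) and R(B) need not be sets of
   [M] for arbitrary [B]. *)
Definition inK V E B (v : num M) : Prop :=
  v ∈ V /\ forall b, b ∈ B -> holds E v b.
Definition inR V E B (v : num M) : Prop :=
  v ∈ V /\ ~ (v ∈ B \/ inK V E B v).

Definition buried_subgraph V E B : Prop :=
  (forall b, b ∈ B -> b ∈ V) /\
  (exists a b, a ∈ B /\ b ∈ B /\ ~ holds E a b) /\
  (~ (exists v, inK V E B v /\ v ∈ B) /\ exists r, inR V E B r) /\
  (forall b r, b ∈ B -> inR V E B r -> ~ holds E b r).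

End Graphs.

Definition unique_orderability_characterization (M : l2_structure) : Prop :=
  forall V E : sets M,
    connected V E -> interval_graph V E ->
    (uniquely_orderable V E <-> ~ exists B : sets M, buried_subgraph V E B).

(* Main.v *)
(** If [B] is buried then every vertex outside [B] is adjacent to all of [B] or
    to none of it, so one can reverse an associated order on [B]
    alone and place [B] where one of its vertices was. The result is neither the
    old order nor its dual.

    Conversely let [P] and [Q] be associated orders, different and not dual to
    each other. A nonadjacent pair is an agreement or a clash according to
    whether [P] and [Q] order it in the same way. Two nonadjacent pairs sharing a
    vertex [x], one of each kind, have nonadjacent other ends. As an interval
    graph has no induced 4-cycle, it follows that, after replacing [Q] by its
    dual if necessary, some clash [u], [v] lies in the neighbourhood by
    agreement of a vertex [w]. The component of [u] under clashes inside that
    neighbourhood is buried, and ACA0 proves that it exists.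

    For the reversal, to form the set of [n] with [Z n l] for some [l], take a
    graph with a root [0], a vertex [1] adjacent to all, left vertices [x_n] and
    right vertices [y_m], where the root is nonadjacent to all [x_n] and [y_m],
    and [x_n] is nonadjacent to [y_m] iff [Z n l] for some [l < m]. It is an
    interval graph since this condition is monotone in [m]. Putting [x_n] below
    [y_m] or above it gives two associated orders with the root at the bottom,
    and every buried subgraph contains [x_n] iff [n] is in the required set. *)

From Stdlib Require Import Classical Lia Ring Setoid.
Require Import Defs.

Set Implicit Arguments.
Unset Strict Implicit.
Unset Printing Implicit Defensive.

Local Open Scope l2_scope.

(** * Formula abbreviations and the syntax of bounded formulas *)

Notation "# n" := (tVar n) (at level 1, format "# n").
Definition tPair (t u : term) : term :=
  tAdd (tMul (tAdd t u) (tAdd t u)) t.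
Definition fHolds (X : nat) (t u : term) : formula := fMem (tPair t u) X.

Definition fIff (p q : formula) : formula := fAnd (fImp p q) (fImp q p).
(** The syntactic form of [coded]. The quotient is the bound variable [#0], so the three terms are
    lifted past it. *)
Definition fCoded (m c i : term) : formula :=
  fExLt (tAdd c tOne)
    (fEq (lift c) (tMul (tAdd (tMul (tAdd (lift i) tOne) (lift m)) tOne) #0)).

Ltac solve_bounded :=
  repeat first [ apply bounded_all | apply bounded_ex | apply bounded_not
               | apply bounded_and | apply bounded_or | apply bounded_imp
               | apply bounded_eq | apply bounded_lt | apply bounded_mem ].

(** ** Comprehension and arithmetic in a model of RCA0 *)

Section Model.
Context (M : l2_structure) (hM : models_RCA0 M).
Implicit Types (x y z u v w i j k l m n : num M) (X Y : sets M).
Implicit Types (e : nat -> num M) (s : nat -> sets M).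

Let ax : basic_axioms M := proj1 hM.

(* Conjoining [p] with an equation makes it both Sigma01 and Pi01; as a result
   the comprehension variable occurs twice and the parameters start at
   index 2. *)
Lemma bounded_comprehension p e s : bounded p ->
  exists X, forall n, n ∈ X <-> sat (scons n (scons n e)) s p.
Proof.
  intro Hp.
  destruct (proj2 (proj2 hM) (fEx (fAnd (fEq #0 #1) p))
              (fAll (fImp (fEq #0 #1) p)) e s) as [X HX].
  - now repeat constructor.
  - now repeat constructor.
  - intro n; simpl; split.
    + intros [a [-> H]] b ->; exact H.
    + intro H; exists n; auto.
  - exists X; intro n; rewrite HX; simpl; split.
    + now intros [a [-> H]].
    + intro H; exists n; auto.
Qed.

Lemma set_ind_RCA X :
  0 ∈ X -> (forall n, n ∈ X -> n + 1 ∈ X) -> forall n, n ∈ X.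
Proof.
  intros H0 HS n.
  (* A dummy existential quantifier makes membership a Sigma01 formula. *)
  enough (sat (scons n (fun _ => 0)) (fun _ => X) (fEx (fMem #1 0))) as [a H]
    by exact H.
  revert n; apply (proj1 (proj2 hM)).
  - now repeat constructor.
  - now exists 0.
  - intros n [a H]; exists 0; now apply HS.
Qed.

Lemma bounded_induction p e s : bounded p ->
  sat (scons 0 (scons 0 e)) s p ->
  (forall n, sat (scons n (scons n e)) s p ->
     sat (scons (n + 1) (scons (n + 1) e)) s p) ->
  forall n, sat (scons n (scons n e)) s p.
Proof.
  intros Hp H0 HS n.
  destruct (bounded_comprehension e s Hp) as [X HX].
  apply HX; apply set_ind_RCA; [now apply HX|].
  now intros k Hk; apply HX; apply HS; apply HX.
Qed.

(** The formulas passed to these tactics have no set variables, so any constant set environment will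
    do. In [induct_ex] index 0 is the witness and index 1 the induction variable. *)
Local Ltac induct p e :=
  let X := fresh "X" in destruct (sets_inhabited M) as [X];
  refine (@bounded_induction p e (fun _ => X) _ _ _);
  [solve_bounded | simpl | simpl].
Local Ltac induct_ex p e :=
  let X := fresh "X" in destruct (sets_inhabited M) as [X];
  refine (proj1 (proj2 hM) (fEx p) e (fun _ => X) _ _ _);
  [constructor; solve_bounded | simpl | simpl].

Local Notation params1 x := (fun _ : nat => x).
Local Notation params2 x y := (scons x (fun _ : nat => y)).

(** * Commutative semiring laws *)

Lemma add_0_l : forall n, 0 + n = n.
Proof.
  induct (fEq (tAdd tZero #0) #0) (fun _ : nat => @zero M).
  - apply (add_0 ax).
  - intros n IH; now rewrite (add_succ ax), IH.
Qed.

Lemma add_succ_l m : forall n, (m + 1) + n = (m + n) + 1.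
Proof.
  induct (fEq (tAdd (tAdd #2 tOne) #0) (tAdd (tAdd #2 #0) tOne)) (params1 m).
  - now rewrite !(add_0 ax).
  - intros n IH; now rewrite !(add_succ ax), IH.
Qed.

Lemma add_comm m : forall n, m + n = n + m.
Proof.
  induct (fEq (tAdd #2 #0) (tAdd #0 #2)) (params1 m).
  - now rewrite (add_0 ax), add_0_l.
  - intros n IH; now rewrite (add_succ ax), add_succ_l, IH.
Qed.

Lemma add_assoc m n : forall k, m + (n + k) = (m + n) + k.
Proof.
  induct (fEq (tAdd #2 (tAdd #3 #0)) (tAdd (tAdd #2 #3) #0)) (params2 m n).
  - now rewrite !(add_0 ax).
  - intros k IH; now rewrite !(add_succ ax), IH.
Qed.

Lemma mul_0_l : forall n, 0 * n = 0.
Proof.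
  induct (fEq (tMul tZero #0) tZero) (fun _ : nat => @zero M).
  - apply (mul_0 ax).
  - intros n IH; now rewrite (mul_succ ax), IH, (add_0 ax).
Qed.

Lemma mul_succ_l m : forall n, (m + 1) * n = m * n + n.
Proof.
  induct (fEq (tMul (tAdd #2 tOne) #0) (tAdd (tMul #2 #0) #0)) (params1 m).
  - now rewrite !(mul_0 ax), (add_0 ax).
  - intros n IH; rewrite !(mul_succ ax), IH, !(add_succ ax).
    f_equal; rewrite <- !add_assoc; f_equal; apply add_comm.
Qed.

Lemma mul_comm m : forall n, m * n = n * m.
Proof.
  induct (fEq (tMul #2 #0) (tMul #0 #2)) (params1 m).
  - now rewrite (mul_0 ax), mul_0_l.
  - intros n IH; now rewrite (mul_succ ax), mul_succ_l, IH.
Qed.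

Lemma mul_add_l m n : forall k, (m + n) * k = m * k + n * k.
Proof.
  induct (fEq (tMul (tAdd #2 #3) #0) (tAdd (tMul #2 #0) (tMul #3 #0)))
    (params2 m n).
  - now rewrite !(mul_0 ax), (add_0 ax).
  - intros k IH; rewrite !(mul_succ ax), IH, <- !add_assoc; f_equal.
    rewrite !add_assoc; f_equal; apply add_comm.
Qed.

Lemma mul_assoc m n : forall k, m * (n * k) = (m * n) * k.
Proof.
  induct (fEq (tMul #2 (tMul #3 #0)) (tMul (tMul #2 #3) #0)) (params2 m n).
  - now rewrite !(mul_0 ax).
  - intros k IH; rewrite !(mul_succ ax), <- IH.
    now rewrite (mul_comm m), mul_add_l, (mul_comm m), (mul_comm n m).
Qed.

Lemma mul_1_l n : 1 * n = n.
Proof.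
  rewrite <- (add_0_l 1), mul_succ_l, mul_0_l; apply add_0_l.
Qed.

Lemma num_semiring : semi_ring_theory (@zero M) one add mul eq.
Proof.
  constructor; auto using add_0_l, add_comm, add_assoc, mul_1_l, mul_0_l,
    mul_comm, mul_assoc, mul_add_l.
Qed.

Add Ring num_ring : num_semiring.

(** * Cancellation and the linear order *)

Lemma add_cancel_r m n : forall k, m + k = n + k -> m = n.
Proof.
  induct (fImp (fEq (tAdd #2 #0) (tAdd #3 #0)) (fEq #2 #3)) (params2 m n).
  - now rewrite !(add_0 ax).
  - intros k IH H; apply IH, (succ_inj ax); now rewrite <- !(add_succ ax).
Qed.

Lemma lt_add m : forall n, m < m + n + 1.
Proof.
  induct (fLt #2 (tAdd (tAdd #2 #0) tOne)) (params1 m).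
  - apply (lt_succ ax); right; now ring_simplify.
  - intros n IH; apply (lt_succ ax); left; now rewrite (add_succ ax).
Qed.

Lemma lt_exists m n : m < n <-> exists k, n = m + k + 1.
Proof.
  split; [|intros [k ->]; apply lt_add].
  (* With the existential in front of the implication the induction formula is Sigma01. Where
     [m < n] fails the witness is the default 0, which is also right for [m + 1]. *)
  enough (exists k, m < n -> n = m + k + 1) as [k H]
    by (intro Hmn; exists k; auto).
  revert n.
  induct_ex (fImp (fLt #2 #1) (fEq #1 (tAdd (tAdd #2 #0) tOne))) (params1 m).
  - exists 0; intro H; now destruct (not_lt_0 ax H).
  - intros n [k IH]; destruct (classic (m < n)) as [Hmn | Hmn].
    + exists (k + 1); intros _; rewrite (IH Hmn) at 1; ring.
    + exists 0; intros [H | ->]%(lt_succ ax); [contradiction | ring].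
Qed.

Lemma lt_irrefl m : ~ m < m.
Proof.
  intros [k H]%lt_exists; apply (succ_neq0 ax (n := k)).
  apply add_cancel_r with m; rewrite H at 2; ring.
Qed.

Lemma lt_trans m n k : m < n -> n < k -> m < k.
Proof.
  intros [a ->]%lt_exists [b ->]%lt_exists; apply lt_exists.
  exists (a + b + 1); ring.
Qed.

Lemma zero_or_pos : forall n, n = 0 \/ 0 < n.
Proof.
  induct (fOr (fEq #0 tZero) (fLt tZero #0)) (fun _ : nat => @zero M).
  - now left.
  - intros n _; right; apply lt_exists; exists n; ring.
Qed.

Lemma zero_or_succ n : n = 0 \/ exists m, n = m + 1.
Proof.
  destruct (zero_or_pos n) as [| [k ->]%lt_exists]; [now left|].
  right; exists k; ring.
Qed.

Lemma one_neq0 : @one M <> 0.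
Proof. rewrite <- (add_0_l 1); apply (succ_neq0 ax). Qed.

Lemma two_neq0 : @one M + 1 <> 0.
Proof. apply (succ_neq0 ax). Qed.

Lemma two_neq1 : @one M + 1 <> 1.
Proof. rewrite <- (add_0_l 1) at 3; intros H%(succ_inj ax); now apply one_neq0. Qed.

Lemma lt_0_succ n : 0 < n + 1.
Proof. apply lt_exists; exists n; ring. Qed.

Lemma lt_trichotomy m : forall n, m < n \/ m = n \/ n < m.
Proof.
  induct (fOr (fLt #2 #0) (fOr (fEq #2 #0) (fLt #0 #2))) (params1 m).
  - destruct (zero_or_pos m) as [-> | H]; auto.
  - intros n [H | [-> | H]].
    + left; apply (lt_succ ax); auto.
    + left; apply (lt_succ ax); auto.
    + right; apply lt_exists in H as [k ->].
      destruct (zero_or_pos k) as [-> | [j ->]%lt_exists].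
      * left; ring.
      * right; apply lt_exists; exists j; ring.
Qed.

Lemma lt_add_1 m n : m + 1 < n + 1 <-> m < n.
Proof.
  rewrite !lt_exists; split; intros [k H]; exists k.
  - apply (succ_inj ax); rewrite H; ring.
  - rewrite H; ring.
Qed.

(** * The pairing function *)

Lemma pair_le_l i j : i < pair i j + 1.
Proof. apply lt_exists; exists ((i + j) * (i + j)); unfold pair; ring. Qed.

Lemma pair_le_r i j : j < pair i j + 1.
Proof.
  apply lt_exists; unfold pair.
  destruct (zero_or_succ j) as [-> | [k ->]].
  - exists (i * i + i); ring.
  - exists (i * i + i * k + i * k + i + i + i + k * k + k); ring.
Qed.

(** With [s = i + j], already [(s + 1) * (s + 1)] exceeds [s * s + s], which is at least
    [pair i j]. *)
Lemma pair_sum_lt i j i' j' : i + j < i' + j' -> pair i j < pair i' j'.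
Proof.
  intros [k H]%lt_exists; apply lt_exists; unfold pair; rewrite H.
  exists ((k * k + k + k) + (i + j) * (k + k) + (i + j) + j + i'); ring.
Qed.

(** The sum of the components is recovered first, by [pair_sum_lt]; cancelling its square leaves the
    first component. *)
Lemma pair_inj i j i' j' : pair i j = pair i' j' -> i = i' /\ j = j'.
Proof.
  intro H.
  assert (Hs : i + j = i' + j').
  { destruct (lt_trichotomy (i + j) (i' + j')) as [Hlt|[|Hlt]]; trivial;
      apply pair_sum_lt in Hlt; rewrite H in Hlt; now apply lt_irrefl in Hlt. }
  assert (Hi : i = i').
  { unfold pair in H; rewrite Hs, (add_comm _ i), (add_comm _ i') in H.
    now apply add_cancel_r in H. }
  split; [assumption|]; subst i'.
  rewrite !(add_comm i) in Hs; now apply add_cancel_r in Hs.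
Qed.

Lemma pair_inj_iff i j i' j' : pair i j = pair i' j' <-> i = i' /\ j = j'.
Proof. split; [apply pair_inj | now intros [-> ->]]. Qed.

(* In [p] the second component, the first component and the pair have indices
   0, 1 and 2. *)
Definition fPairs (p : formula) : formula :=
  fExLt (tAdd #0 tOne) (fExLt (tAdd #1 tOne) (fAnd (fEq #2 (tPair #1 #0)) p)).

Lemma relation_of_pairs X (R : num M -> num M -> num M -> Prop) :
  (forall z, z ∈ X <-> exists x, x < z + 1 /\ exists y, y < z + 1 /\
     z = pair x y /\ R x y z) ->
  (forall z, z ∈ X -> exists x y, z = pair x y) /\
  (forall x y, holds X x y <-> R x y (pair x y)).
Proof.
  intro H; split.
  - intros z (x & _ & y & _ & -> & _)%H; eauto.
  - intros x y; unfold holds; rewrite H; split.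
    + now intros (x' & _ & y' & _ & [-> ->]%pair_inj & HR).
    + intro HR; exists x; split; [apply pair_le_l|].
      exists y; split; [apply pair_le_r|]; auto.
Qed.

(** Indices 2 and 3 of [p] both hold the pair, so number parameters start at index 4. *)
Lemma bounded_relation p e s : bounded p ->
  exists X, (forall z, z ∈ X -> exists x y, z = pair x y) /\
    forall x y, holds X x y <->
      sat (scons y (scons x (scons (pair x y) (scons (pair x y) e)))) s p.
Proof.
  intro Hp.
  destruct (@bounded_comprehension (fPairs p) e s) as [X HX].
  - unfold fPairs; solve_bounded; exact Hp.
  - exists X; exact (relation_of_pairs (R := fun x y z =>
      sat (scons y (scons x (scons z (scons z e)))) s p) HX).
Qed.


(** ** Coding of finite sets *)

Definition dvd (d a : num M) : Prop := exists q, a = d * q.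

Lemma add_eq_0 m n : m + n = 0 -> m = 0.
Proof.
  destruct (zero_or_succ m) as [|[k ->]]; [trivial|].
  rewrite add_succ_l; intro H; now destruct (succ_neq0 ax H).
Qed.

Lemma dvd_mul_r d a b : dvd d a -> dvd d (a * b).
Proof. intros [q ->]; exists (q * b); ring. Qed.

(** There is no subtraction, so the two quotients are compared: unless [q < r], the summand [b] is
    0. *)
Lemma dvd_add_cancel d a b : dvd d a -> dvd d (a + b) -> dvd d b.
Proof.
  intros [q ->] [r H].
  destruct (lt_trichotomy q r) as [[k ->]%lt_exists | [-> | [k ->]%lt_exists]].
  - exists (k + 1); apply add_cancel_r with (d * q).
    rewrite (add_comm b), H; ring.
  - exists 0; apply add_cancel_r with (d * r).
    rewrite (add_comm b), H; ring.
  - exists 0; rewrite (mul_0 ax); apply add_eq_0 with (d * (k + 1)).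
    apply add_cancel_r with (d * r); rewrite add_0_l.
    transitivity (d * (r + k + 1) + b); [ring | exact H].
Qed.

Definition modulus m i : num M := (i + 1) * m + 1.

(* Modulo [d = (i + 1) * m + 1] the number [(i + 1) * m] is [-1], so [m], and
   with it every divisor [h] of [m], is invertible. *)
Lemma modulus_cancel m i h c : dvd h m ->
  dvd (modulus m i) (c * (h * m)) -> dvd (modulus m i) c.
Proof.
  intros [t Ht] H.
  set (a := (i + 1) * m).
  assert (Haa : dvd (modulus m i) (c * (a * a))).
  { replace (c * (a * a)) with (c * (h * m) * (t * ((i + 1) * (i + 1)))).
    - now apply dvd_mul_r.
    - unfold a; rewrite Ht at 2 3; rewrite Ht at 1; ring. }
  assert (Ha : dvd (modulus m i) (c * a)).
  { apply dvd_add_cancel with (c * (a * a)); [exact Haa|].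
    exists (c * a); unfold modulus; fold a; ring. }
  apply dvd_add_cancel with (c * a); [exact Ha|].
  exists c; unfold modulus; fold a; ring.
Qed.

(** The moduli differ by [(h + 1) * m], where [h + 1] is the distance of [i] and [j]. Hence
    [modulus m i] divides [c * ((h + 1) * m)], and [modulus_cancel] applies. *)
Lemma modulus_coprime m i j c :
  (forall h, i = j + h + 1 \/ j = i + h + 1 -> dvd (h + 1) m) ->
  i <> j -> dvd (modulus m i) (c * modulus m j) -> dvd (modulus m i) c.
Proof.
  intros Hm Hij H.
  destruct (lt_trichotomy i j) as [[h E]%lt_exists | [| [h E]%lt_exists]];
    [| contradiction |]; apply (modulus_cancel (h := h + 1)); auto.
  - apply dvd_add_cancel with (c * modulus m i).
    + exists c; ring.
    + replace (_ + _) with (c * modulus m j); [exact H|].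
      rewrite E; unfold modulus; ring.
  - apply dvd_add_cancel with (c * modulus m j); [exact H|].
    exists c; rewrite E; unfold modulus; ring.
Qed.

Lemma dvd_bounded d a :
  dvd (d + 1) a <-> exists q, q < a + 1 /\ a = (d + 1) * q.
Proof.
  split; [|intros [q [_ Hq]]; now exists q].
  intros [q ->]; exists q; split; [|reflexivity].
  apply lt_exists; exists (d * q); ring.
Qed.

(** A substitute for the factorial, multiplied by [k + 1] at each induction step. The quotients are
    bounded to keep the induction formula Sigma01. *)
Lemma common_multiple k : exists m, 0 < m /\ forall h, h < k -> dvd (h + 1) m.
Proof.
  enough (exists m, 0 < m /\
    forall h, h < k -> exists q, q < m + 1 /\ m = (h + 1) * q) as [m [H0 Hm]].
  { exists m; split; [exact H0|]; intros h Hh; apply dvd_bounded; auto. }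
  revert k.
  induct_ex (fAnd (fLt tZero #0)
    (fAllLt #1 (fExLt (tAdd #1 tOne) (fEq #2 (tMul (tAdd #1 tOne) #0)))))
    (fun _ : nat => @zero M).
  - exists 1; split; [rewrite <- (add_0_l 1); apply lt_0_succ|].
    intros h H; now destruct (not_lt_0 ax H).
  - intros k [m [[m' Hm']%lt_exists Hm]]; exists (m * (k + 1)); split.
    + apply lt_exists; exists (m' * k + m' + k); rewrite Hm'; ring.
    + intros h [Hh | ->]%(lt_succ ax); apply dvd_bounded.
      * now apply dvd_mul_r, dvd_bounded, Hm.
      * exists m; ring.
Qed.

(** As in the Goedel beta function, [c] codes the set of those [i] whose modulus divides [c]. *)
Definition coded m c i : Prop :=
  exists q, q < c + 1 /\ c = modulus m i * q.

Lemma coded_dvd m c i : coded m c i <-> dvd (modulus m i) c.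
Proof. symmetry; apply dvd_bounded. Qed.

(** The code is the product of the moduli of the elements of [X] below [k]; by coprimality no other
    modulus of an index below [k] divides it. *)
Lemma coding X k : exists m c, forall i, i < k -> (coded m c i <-> i ∈ X).
Proof.
  destruct (common_multiple k) as [m [Hm0 Hm]]; exists m.
  enough (exists c, forall i, i < k -> (coded m c i <-> i < k /\ i ∈ X))
    as [c Hc] by (exists c; intros i Hi; rewrite Hc; tauto).
  (* The induction is on the part of [X] already multiplied in, with [m] and the range [i < k]
     fixed. *)
  generalize k at 2; intro j; revert j.
  refine (proj1 (proj2 hM) (fEx (fAllLt #2 (fIff (fCoded #4 #1 #0)
    (fAnd (fLt #0 #2) (fMem #0 0))))) (scons k (scons m (fun _ => 0)))
    (fun _ => X) _ _ _).
  - constructor; unfold fIff; solve_bounded.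
  (* The empty product: since [m] is positive, every modulus exceeds 1. *)
  - exists 1; intros i Hi; change (coded m 1 i <-> i < 0 /\ i ∈ X).
    rewrite coded_dvd; split; [|now intros [H%(not_lt_0 ax) _]].
    intros [q Hq]; exfalso; destruct (zero_or_succ q) as [-> | [q' ->]].
    + rewrite (mul_0 ax), <- (add_0_l 1) in Hq; now apply (succ_neq0 ax) in Hq.
    + apply (lt_irrefl (m := 1)); rewrite Hq at 2.
      apply lt_exists in Hm0 as [m' ->]; apply lt_exists.
      exists (i * (m' + 1) * (q' + 1) + m' * (q' + 1) + q' + q').
      unfold modulus; ring.
  - intros j [c Hc].
    change (forall i, i < k -> (coded m c i <-> i < j /\ i ∈ X)) in Hc.
    enough (exists c', forall i, i < k -> (coded m c' i <-> i < j + 1 /\ i ∈ X))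
      by assumption.
    destruct (classic (j < k /\ j ∈ X)) as [[Hj HjX] | Hj].
    + exists (c * modulus m j); intros i Hi.
      rewrite coded_dvd, (lt_succ ax).
      destruct (classic (i = j)) as [-> | Hij].
      { split; [now auto|]; intros _; exists c; ring. }
      transitivity (i < j /\ i ∈ X); [|tauto].
      rewrite <- (Hc i Hi), coded_dvd; split; [|apply dvd_mul_r].
      apply modulus_coprime; [|exact Hij].
      intros h E; apply Hm; destruct E as [-> | ->];
        [apply lt_trans with (j + h + 1) | apply lt_trans with (i + h + 1)];
        trivial; apply lt_exists; [exists j | exists i]; ring.
    + exists c; intros i Hi; rewrite (Hc i Hi), (lt_succ ax); split; [tauto|].
      intros [[H | ->] HX]; [auto | tauto].
Qed.

(** ** Associated orders and buried subgraphs *)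

Lemma sub_prod_holds (R A B : sets M) x y :
  sub_prod R A B -> holds R x y -> x ∈ A /\ y ∈ B.
Proof. now intros HR (x' & y' & Hx & Hy & [-> ->]%pair_inj)%HR. Qed.

Lemma sub_prod_intro (R A B : sets M) :
  (forall z, z ∈ R -> exists x y, z = pair x y) ->
  (forall x y, holds R x y -> x ∈ A /\ y ∈ B) -> sub_prod R A B.
Proof.
  intros HR H z Hz; destruct (HR z Hz) as (x & y & ->).
  destruct (H x y Hz); eauto.
Qed.

Lemma dual_exists (V E P : sets M) :
  associated_order V E P ->
  exists Q, associated_order V E Q /\ dual_order P Q.
Proof.
  intros [(HPV & HPi & HPt) HPE].
  destruct (@bounded_relation (fHolds 0 #0 #1) (fun _ => 0) (fun _ => P))
    as (Q & HQp & HQ); [solve_bounded|].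
  change (forall x y, holds Q x y <-> holds P y x) in HQ; exists Q.
  split; [split; [split; [|split]|]|];
    trivial.
  - apply sub_prod_intro; [exact HQp|].
    intros x y H%HQ; now apply and_comm, sub_prod_holds with P.
  - intros x H%HQ; exact (HPi x H).
  - intros x y z H1%HQ H2%HQ; apply HQ; eauto.
  - intros u v Hu Hv; rewrite HPE, !HQ by trivial; tauto.
Qed.

(* Substitute [B], ordered by the dual of [P], for [a] in the restriction of
   [P] to [a] and the vertices outside [B]. *)
Lemma buried_not_unique (V E : sets M) :
  graph V E -> uniquely_orderable V E -> ~ exists B, buried_subgraph V E B.
Proof.
  intros [_ HEs] (P & [[HPV [HPi HPt]] HPE] & Huniq)
    (B & HBV & (a & b & Ha & Hb & Hab) & (_ & r & HrV & Hr) & HBR).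
  (* A vertex outside [B] lies in K(B) or in R(B), so [a] can stand for any element of [B]. *)
  assert (Hmod : forall u v, u ∈ B -> v ∈ V -> ~ v ∈ B ->
    (holds E u v <-> holds E a v)).
  { intros u v Hu Hv HvB; destruct (classic (inK V E B v)) as [[_ HK] | HK].
    - split; auto.
    - assert (inR V E B v) by (split; tauto).
      split; intro H'; [destruct (HBR u v) | destruct (HBR a v)]; trivial. }
  destruct (@bounded_relation
    (fOr (fAnd (fMem #1 1) (fAnd (fMem #0 1) (fHolds 0 #0 #1)))
    (fOr (fAnd (fMem #1 1) (fAnd (fNot (fMem #0 1)) (fHolds 0 #4 #0)))
    (fOr (fAnd (fNot (fMem #1 1)) (fAnd (fMem #0 1) (fHolds 0 #1 #4)))
      (fAnd (fNot (fMem #1 1)) (fAnd (fNot (fMem #0 1)) (fHolds 0 #1 #0))))))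
    (fun _ => a) (scons P (fun _ => B))) as (Q & HQp & HQ); [solve_bounded|].
  change (forall x y, holds Q x y <->
    (x ∈ B /\ y ∈ B /\ holds P y x) \/
    (x ∈ B /\ ~ y ∈ B /\ holds P a y) \/
    (~ x ∈ B /\ y ∈ B /\ holds P x a) \/
    (~ x ∈ B /\ ~ y ∈ B /\ holds P x y)) in HQ.
  assert (HaV : a ∈ V) by auto.
  assert (HPv : forall x y, holds P x y -> x ∈ V /\ y ∈ V)
    by (intros x y; now apply sub_prod_holds).
  assert (HPa : forall x y, holds P x y -> ~ holds P y x)
    by (intros x y H1 H2; exact (HPi x (HPt _ _ _ H1 H2))).
  assert (HrB : ~ r ∈ B) by tauto.
  assert (Har : holds P a r \/ holds P r a)
    by (apply HPE; trivial; apply HBR; [trivial | split; trivial]).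
  assert (Hab' : holds P a b \/ holds P b a) by (apply HPE; auto).
  destruct (Huniq Q) as [Hs | Hd].
  - split; [split; [|split]|].
    + apply sub_prod_intro; [exact HQp|].
      intros x y H; rewrite HQ in H.
      destruct H as [(H1 & H2 & H3) | [(H1 & H2 & H3) |
        [(H1 & H2 & H3) | (H1 & H2 & H3)]]];
        apply HPv in H3 as []; auto.
    + intro x; rewrite HQ; specialize (HPi x); tauto.
    + intros x y z; rewrite !HQ.
      intros [(Hx & Hy & H) | [(Hx & Hy & H) | [(Hx & Hy & H) | (Hx & Hy & H)]]]
        [(Hy' & Hz & H') | [(Hy' & Hz & H') | [(Hy' & Hz & H') | (Hy' & Hz & H')]]];
        try contradiction;
        first [ now destruct (HPa _ _ H H') | left; now eauto
              | right; left; now eauto | right; right; left; now eauto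
              | right; right; right; now eauto ].
    + intros u v Hu Hv; rewrite !HQ.
      destruct (classic (u ∈ B)) as [HuB | HuB], (classic (v ∈ B)) as [HvB | HvB].
      * rewrite HPE by trivial; clear - HuB HvB; tauto.
      * rewrite Hmod, HPE by trivial; clear - HuB HvB; tauto.
      * transitivity (~ holds E a u).
        { rewrite <- (Hmod v u) by trivial; split; auto. }
        rewrite HPE by trivial; clear - HuB HvB; tauto.
      * rewrite HPE by trivial; clear - HuB HvB; tauto.
  (* [Q] reverses [P] on [a], [b], both inside [B], but keeps it on [a] and the outside vertex
     [r]. *)
  - specialize (HPa a b); specialize (Hs a b); rewrite HQ in Hs; tauto.
  - specialize (HPa a r); specialize (Hd a r); rewrite HQ in Hd; tauto.
Qed.

(** The two intervals are disjoint and convex. If [q'] came before [p'], then either [q'] would lie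
    between [p] and [p'], or [p] between [q'] and [q]. *)
Lemma intervals_ordered (L R F V E : sets M) a b p q p' q' :
  interval_representation V E L R F -> a ∈ V -> b ∈ V -> ~ holds E a b ->
  holds F a p -> holds F b q -> holds F a p' -> holds F b q' ->
  holds R p q -> holds R p' q'.
Proof.
  intros ([[_ [_ Rt]] Rtot] & HF & _ & Hconv & HE) Ha Hb Hab Fp Fq Fp' Fq' Hpq.
  assert (Hd : forall x, holds F a x -> ~ holds F b x)
    by (intros x H1 H2; apply Hab; apply HE; eauto).
  assert (HL : forall v x, holds F v x -> x ∈ L)
    by (intros v x H; now apply (sub_prod_holds HF) in H).
  destruct (Rtot p' q') as [| [<- | H]]; eauto; [now destruct (Hd p')|].
  destruct (Rtot p q') as [H' | [<- | H']]; eauto.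
  - destruct (Hd q'); trivial; apply Hconv with p p'; eauto.
  - now destruct (Hd p).
  - destruct (Hd p); trivial; apply Hconv with q' q; eauto.
Qed.

(** If [F a] lies before [F b], the intervals of [c] and [d] both reach from [F a] to [F b]. The
    later of the points chosen in [F a] for [c] and for [d] then belongs to both. *)
Lemma interval_graph_no_C4 (V E : sets M) a b c d :
  interval_graph V E -> a ∈ V -> b ∈ V -> c ∈ V -> d ∈ V ->
  ~ holds E a b -> ~ holds E c d ->
  holds E a c -> holds E a d -> holds E b c -> ~ holds E b d.
Proof.
  intros [_ (L & R & F & Hrep)] Ha Hb Hc Hd Hab Hcd Hac Had Hbc Hbd.
  pose proof Hrep as ([_ Rtot] & HF & _ & Hconv & HE).
  assert (HL : forall v x, holds F v x -> x ∈ L)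
    by (intros v x H; now apply (sub_prod_holds HF) in H).
  assert (Hcd' : forall x, holds F c x -> ~ holds F d x)
    by (intros x H1 H2; apply Hcd; apply HE; eauto).
  apply HE in Hac as (x & Hax & Hcx), Had as (x' & Hax' & Hdx'),
    Hbc as (y & Hby & Hcy), Hbd as (y' & Hby' & Hdy'); trivial.
  assert (core : forall a b x x' y y', a ∈ V -> b ∈ V -> ~ holds E a b ->
    holds F a x -> holds F a x' -> holds F b y -> holds F b y' ->
    holds F c x -> holds F d x' -> holds F c y -> holds F d y' ->
    holds R x y -> False).
  { clear - ax Hrep Rtot Hc Hd HL Hcd' Hconv.
    intros a b x x' y y' Ha Hb Hab Hax Hax' Hby Hby' Hcx Hdx' Hcy Hdy' Hxy.
    pose proof (intervals_ordered Hrep Ha Hb Hab Hax Hby Hax' Hby Hxy).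
    pose proof (intervals_ordered Hrep Ha Hb Hab Hax Hby Hax Hby' Hxy).
    destruct (Rtot x x') as [Hxx | [<- | Hxx]]; eauto.
    - apply (Hcd' x'); trivial; apply Hconv with x y; eauto.
    - now apply (Hcd' x).
    - apply (Hcd' x); trivial; apply Hconv with x' y'; eauto. }
  destruct (Rtot x y (HL a x Hax) (HL b y Hby)) as [H | [<- | H]].
  - apply core with a b x x' y y'; trivial.
  - apply Hab; apply HE; eauto.
  - apply core with b a y y' x x'; trivial.
    intro H'; apply Hab; apply HE in H' as (z & Hz & Hz'); trivial.
    apply HE; eauto.
Qed.

Definition agree (P Q : sets M) x y : Prop :=
  (holds P x y /\ holds Q x y) \/ (holds P y x /\ holds Q y x).
Definition clash (P Q : sets M) x y : Prop :=
  (holds P x y /\ holds Q y x) \/ (holds P y x /\ holds Q x y).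
Definition fAgree (P Q : nat) (t u : term) : formula :=
  fOr (fAnd (fHolds P t u) (fHolds Q t u)) (fAnd (fHolds P u t) (fHolds Q u t)).
Definition fClash (P Q : nat) (t u : term) : formula :=
  fOr (fAnd (fHolds P t u) (fHolds Q u t)) (fAnd (fHolds P u t) (fHolds Q t u)).

(** ** Closures and buried subgraphs in ACA0 *)

Section ACA.
Context (hA : arithmetical_comprehension M).

Lemma arithmetical_relation p e s : arithmetical p ->
  exists X, (forall z, z ∈ X -> exists x y, z = pair x y) /\
    forall x y, holds X x y <-> sat (scons y (scons x (scons (pair x y) e))) s p.
Proof.
  intro Hp.
  destruct (hA (p := fPairs p) e s) as [X HX]; [now simpl|].
  exists X; exact (relation_of_pairs (R := fun x y z =>
    sat (scons y (scons x (scons z e))) s p) HX).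
Qed.

(* Membership in the closure is expressed without a quantifier over paths: [y]
   is in the closure iff for some [k] every finite set containing [u] and closed
   under [G] below [k] contains [y]. *)
Lemma closure_exists (G : sets M) u : exists B,
  u ∈ B /\ (forall a b, a ∈ B -> holds G a b -> b ∈ B) /\
  (forall X, u ∈ X -> (forall a b, a ∈ X -> holds G a b -> b ∈ X) ->
     forall y, y ∈ B -> y ∈ X).
Proof.
  destruct (hA (p := fEx (fAnd (fLt #2 #0) (fAnd (fLt #1 #0) (fAll (fAll
    (fImp (fAnd (fCoded #1 #0 #4)
       (fAllLt #2 (fAllLt #3 (fImp (fCoded #3 #2 #1)
          (fImp (fHolds 0 #1 #0) (fCoded #3 #2 #0))))))
       (fCoded #1 #0 #3))))))) (fun _ => u) (fun _ => G)) as [B HB];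
    [simpl; tauto|].
  set (closed := fun k m c => coded m c u /\ forall a, a < k -> forall b, b < k ->
    coded m c a -> holds G a b -> coded m c b).
  change (forall y, y ∈ B <-> exists k, u < k /\ y < k /\
    forall m c, closed k m c -> coded m c y) in HB.
  exists B; split; [|split].
  - apply HB; exists (u + 1); rewrite (lt_succ ax); split; [auto|split; [auto|]].
    now intros m c [H _].
  - intros a b [k (Hu & Ha & Hk)]%HB Hab; apply HB.
    (* The new bound also exceeds [b], and a code closed below it is closed below [k]. *)
    exists (k + b + 1).
    assert (Hlt : forall x, x < k -> x < k + b + 1)
      by (intros x Hx; apply lt_trans with k; trivial; apply lt_add).
    assert (Hb : b < k + b + 1) by (rewrite (add_comm k); apply lt_add).
    split; [auto | split; [exact Hb|]].
    intros m c [Hc1 Hc2]; apply Hc2 with a; auto.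
    apply Hk; split; [exact Hc1|]; intros a' Ha' b' Hb'; apply Hc2; auto.
  - intros X Hu HX y [k (Huk & Hyk & Hk)]%HB.
    (* [X] may be infinite, but only its part below [k] matters, and that part has a code. *)
    destruct (coding X k) as [m [c Hc]]; apply Hc; [exact Hyk|]; apply Hk.
    split; [now apply Hc|]; intros a Ha b Hb; rewrite !Hc by trivial; apply HX.
Qed.

(** * Agreements and clashes of two associated orders *)

Section TwoOrders.
Context (V E P Q : sets M).
Context (HE : graph V E) (HP : associated_order V E P)
  (HQ : associated_order V E Q).

Lemma assoc_holds (S : sets M) x y : associated_order V E S -> holds S x y ->
  x ∈ V /\ y ∈ V /\ ~ holds E x y /\ ~ holds S y x.
Proof.
  intros [(HSV & HSi & HSt) HSE] H.
  destruct (sub_prod_holds HSV H) as [Hx Hy].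
  split; [exact Hx | split; [exact Hy | split]].
  - apply HSE; auto.
  - intro H'; exact (HSi x (HSt _ _ _ H H')).
Qed.

Lemma assoc_trans (S : sets M) x y z :
  associated_order V E S -> holds S x y -> holds S y z -> holds S x z.
Proof. intros [(_ & _ & HSt) _]; apply HSt. Qed.

Lemma assoc_adj_refl x : x ∈ V -> holds E x x.
Proof.
  intro Hx; apply NNPP; intro H.
  destruct HP as [(_ & HPi & _) HPE].
  apply HPE in H; trivial; now destruct H as [H | H]; apply HPi in H.
Qed.

Lemma agree_sym x y : agree P Q x y -> agree P Q y x.
Proof. unfold agree; tauto. Qed.
Lemma clash_sym x y : clash P Q x y -> clash P Q y x.
Proof. unfold clash; tauto. Qed.

Lemma agree_or_clash x y : x ∈ V -> y ∈ V -> ~ holds E x y ->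
  agree P Q x y \/ clash P Q x y.
Proof.
  intros Hx Hy H; unfold agree, clash.
  pose proof (proj1 (proj2 HP x y Hx Hy) H).
  pose proof (proj1 (proj2 HQ x y Hx Hy) H); tauto.
Qed.

Lemma agree_nonadj x y : agree P Q x y -> x ∈ V /\ y ∈ V /\ ~ holds E x y.
Proof.
  intros [[H _] | [H _]]; apply (assoc_holds HP) in H as (? & ? & H & _); auto.
  repeat split; trivial; intro; now apply H, (proj2 HE).
Qed.

Lemma clash_nonadj x y : clash P Q x y -> x ∈ V /\ y ∈ V /\ ~ holds E x y.
Proof.
  intros [[H _] | [H _]]; apply (assoc_holds HP) in H as (? & ? & H & _); auto.
  repeat split; trivial; intro; now apply H, (proj2 HE).
Qed.

(** Exactly one of [P] and [Q] puts [x] between [y] and [z]; transitivity of that order makes [y]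
    and [z] comparable. *)
Lemma clash_agree_nonadj x y z :
  clash P Q x y -> agree P Q x z -> ~ holds E y z.
Proof.
  intros [[H1 H2] | [H1 H2]] [[H3 H4] | [H3 H4]] H.
  - now destruct (assoc_holds HQ (assoc_trans HQ H2 H4)) as (_ & _ & N & _).
  - destruct (assoc_holds HP (assoc_trans HP H3 H1)) as (_ & _ & N & _).
    now apply N, (proj2 HE).
  - now destruct (assoc_holds HP (assoc_trans HP H1 H3)) as (_ & _ & N & _).
  - destruct (assoc_holds HQ (assoc_trans HQ H4 H2)) as (_ & _ & N & _).
    now apply N, (proj2 HE).
Qed.

(** If [a], [y] agree, the clash [a], [b] separates [b] from [y]. If they clash, the agreement of
    [a] with [w] makes [w], [y] nonadjacent; these must clash too, and the agreement of [w] with [b]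
    finishes. *)
Lemma clash_step w a b y : y ∈ V ->
  agree P Q w a -> agree P Q w b -> clash P Q a b ->
  ~ (clash P Q a y /\ agree P Q w y) -> ~ holds E a y -> ~ holds E b y.
Proof.
  intros Hy Hwa Hwb Hab Hay HEay.
  destruct (agree_nonadj Hwa) as (Hw & Ha & _).
  destruct (agree_or_clash Ha Hy HEay) as [H | H].
  - exact (clash_agree_nonadj Hab H).
  - assert (Hwy : ~ holds E w y).
    { intro H'; apply (clash_agree_nonadj H (agree_sym Hwa)).
      now apply (proj2 HE). }
    destruct (agree_or_clash Hw Hy Hwy) as [H' | H']; [tauto|].
    intro H''; apply (clash_agree_nonadj H' Hwb); now apply (proj2 HE).
Qed.

(** [B] is the closure of [u] under clashes among the vertices agreeing with [w]. By [clash_step]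
    each vertex outside [B] is adjacent to all of [B] or to none, and [w] lies in R(B). *)
Lemma clash_triangle_buried w u v :
  clash P Q u v -> agree P Q w u -> agree P Q w v ->
  exists B, buried_subgraph V E B.
Proof.
  intros Huv Hwu Hwv.
  destruct (@bounded_relation (fAnd (fClash 0 1 #1 #0) (fAgree 0 1 #4 #0))
    (fun _ => w) (scons P (fun _ => Q))) as (G & _ & HG);
    [unfold fClash, fAgree; solve_bounded|].
  change (forall a b, holds G a b <-> clash P Q a b /\ agree P Q w b) in HG.
  destruct (closure_exists G u) as (B & HuB & HBG & Hmin).
  assert (HBw : forall b, b ∈ B -> agree P Q w b).
  { destruct (@bounded_comprehension (fAgree 0 1 #2 #0) (fun _ => w)
      (scons P (fun _ => Q))) as [X HX]; [unfold fAgree; solve_bounded|].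
    change (forall b, b ∈ X <-> agree P Q w b) in HX.
    intros b Hb; apply HX; apply Hmin; trivial.
    - now apply HX.
    - intros a' b' _ [_ H]%HG; now apply HX. }
  assert (HvB : v ∈ B) by (apply HBG with u; trivial; now apply HG).
  (* The elements of [B] adjacent to [y] exactly when [u] is form a set closed under [G]; minimality
     of [B] gives the rest. *)
  assert (Hmod : forall y, y ∈ V -> ~ y ∈ B ->
    forall b, b ∈ B -> (holds E b y <-> holds E u y)).
  { intros y Hy HyB.
    destruct (@bounded_comprehension
      (fAnd (fMem #0 0) (fIff (fHolds 1 #0 #2) (fHolds 1 #3 #2)))
      (scons y (fun _ => u)) (scons B (fun _ => E))) as [X HX];
      [unfold fIff; solve_bounded|].
    change (forall b, b ∈ X <->
      b ∈ B /\ (holds E b y -> holds E u y) /\ (holds E u y -> holds E b y)) in HX.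
    intros b Hb; apply HX; apply Hmin; trivial; [apply HX; tauto|].
    intros a' b' [Ha' Ha'']%HX Hab'; pose proof (HBG _ _ Ha' Hab') as Hb'.
    apply HX; apply HG in Hab' as [Hab' _].
    assert (Hstep : forall c d, c ∈ B -> d ∈ B -> clash P Q c d ->
      holds E d y -> holds E c y).
    { intros c d Hc Hd Hcd HEd; apply NNPP; intro HEc; revert HEd.
      change (~ holds E d y); apply clash_step with w c; auto.
      intro H; apply HyB; apply HBG with c; trivial; now apply HG. }
    pose proof (Hstep a' b' Ha' Hb' Hab').
    pose proof (Hstep b' a' Hb' Ha' (clash_sym Hab')); tauto. }
  exists B; split; [|split; [|split; [split|]]].
  - intros b Hb; now apply HBw, agree_nonadj in Hb.
  - exists u, v; split; [|split]; trivial; now apply clash_nonadj.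
  (* If [x] were adjacent to all of [B], no clash within [B] could lead to [x], and [B] without [x]
     would be a smaller closed set. It still contains [u], which is nonadjacent to [v]. *)
  - intros (x & [HxV HxK] & HxB).
    destruct (@bounded_comprehension
      (fAnd (fMem #0 0) (fNot (fEq #0 #2))) (fun _ => x) (fun _ => B))
      as [X HX]; [solve_bounded|].
    change (forall b, b ∈ X <-> b ∈ B /\ b <> x) in HX.
    enough (x ∈ X) by (apply HX in H; tauto).
    apply Hmin; trivial.
    + apply HX; split; trivial; intros ->.
      apply clash_nonadj in Huv as (_ & _ & Huv); auto.
    + intros a b [Ha _]%HX Hab; apply HX; split; [now apply HBG with a|].
      intros ->; apply HG in Hab as [Hab _].
      apply clash_sym, clash_nonadj in Hab as (_ & _ & Hab); auto.
  (* [w] is not in K(B) because of [u], and not in [B] because it is adjacent to itself. *)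
  - apply agree_nonadj in Hwu as (HwV & _ & HEwu).
    exists w; split; [trivial|]; intros [H | [_ H]]; [|auto].
    apply HBw, agree_nonadj in H as (_ & _ & H); now apply H, assoc_adj_refl.
  - intros b r Hb [HrV Hr].
    assert (HrB : ~ r ∈ B) by tauto.
    intro H; apply Hr; right; split; trivial.
    intros b' Hb'; apply (proj2 HE); apply (Hmod r); trivial.
    now apply (Hmod r HrV HrB b Hb).
Qed.

End TwoOrders.

(** Nonadjacent vertices are ordered as their intervals are; by [intervals_ordered] the choice of
    points is immaterial. The definition quantifies over points, so it is formed by arithmetical
    comprehension. *)
Lemma interval_graph_orderable (V E : sets M) :
  interval_graph V E -> exists P, associated_order V E P.
Proof.
  intros [HE (L & R & F & Hrep)].
  destruct (@arithmetical_relation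
    (fAnd (fMem #1 0) (fAnd (fMem #0 0) (fAnd (fNot (fHolds 1 #1 #0))
      (fEx (fEx (fAnd (fHolds 3 #3 #1) (fAnd (fHolds 3 #2 #0) (fHolds 2 #1 #0))))))))
    (fun _ => 0) (scons V (scons E (scons R (fun _ => F))))) as (P & HPp & HP);
    [simpl; tauto|].
  change (forall u v, holds P u v <-> u ∈ V /\ v ∈ V /\ ~ holds E u v /\
    exists x y, holds F u x /\ holds F v y /\ holds R x y) in HP.
  pose proof Hrep as ([[_ [Ri Rt]] Rtot] & HF & Hne & _ & HEF).
  assert (HL : forall v x, holds F v x -> x ∈ L)
    by (intros v x H; now apply (sub_prod_holds HF) in H).
  assert (Hbefore : forall u v x y, holds P u v -> holds F u x -> holds F v y ->
    holds R x y).
  { intros u v x y (Hu & Hv & Huv & x' & y' & Hx' & Hy' & H)%HP Hx Hy.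
    exact (intervals_ordered Hrep Hu Hv Huv Hx' Hy' Hx Hy H). }
  assert (Hpt : forall u v, holds P u v ->
    exists x y, holds F u x /\ holds F v y /\ holds R x y)
    by (intros u v H; now apply HP in H).
  exists P; split; [split; [|split]|].
  - apply sub_prod_intro; [exact HPp|]; intros u v H; apply HP in H; tauto.
  - intros u (Hu & _ & Huu & _)%HP; apply Huu; apply HEF; trivial.
    destruct (Hne u Hu) as [x Hx]; eauto.
  - intros u v w Huv Hvw.
    destruct (Hpt _ _ Huv) as (x & y & Hx & Hy & _).
    destruct (Hpt _ _ Hvw) as (y' & z & _ & Hz & _).
    assert (Hxz : holds R x z)
      by (apply Rt with y; [apply (Hbefore u v) | apply (Hbefore v w)]; trivial).
    destruct (proj1 (HP u v) Huv) as (Hu & _), (proj1 (HP v w) Hvw) as (_ & Hw & _).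
    apply HP; split; [|split; [|split]]; eauto 6.
    intros (t & Ht & Ht')%HEF; trivial.
    apply (Ri t), Rt with y; [apply (Hbefore u v) | apply (Hbefore v w)]; trivial.
  - intros u v Hu Hv; split.
    + intro H; destruct (Hne u Hu) as [x Hx], (Hne v Hv) as [y Hy].
      destruct (Rtot x y (HL _ _ Hx) (HL _ _ Hy)) as [Hxy | [<- | Hxy]].
      * left; apply HP; eauto 8.
      * destruct H; apply HEF; eauto.
      * right; apply HP; split; [|split; [|split]]; eauto 6.
        intro; now apply H, (proj2 HE).
    + intros [H | H]; apply HP in H as (_ & _ & H & _); trivial.
      intro; now apply H, (proj2 HE).
Qed.

(** The pair [a], [c] is itself an agreement or a clash, so the two kinds meet at [a] or at [c]. *)
Lemma mixed_vertex (V E P Q : sets M) a b c d :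
  graph V E -> associated_order V E P -> associated_order V E Q ->
  clash P Q a b -> agree P Q c d -> ~ holds E a c ->
  exists x y z, clash P Q x y /\ agree P Q x z.
Proof.
  intros HE HP HQ Hab Hcd Hac.
  destruct (clash_nonadj HE HP Hab) as (Ha & _), (agree_nonadj HE HP Hcd) as (Hc & _).
  destruct (agree_or_clash HP HQ Ha Hc Hac) as [H | H].
  - now exists a, b, c.
  - exists c, a, d; split; [now apply clash_sym | trivial].
Qed.

Lemma unique_if_not_buried (V E : sets M) :
  interval_graph V E -> ~ (exists B, buried_subgraph V E B) ->
  uniquely_orderable V E.
Proof.
  intros Hint HB; pose proof (proj1 Hint) as HE.
  destruct (interval_graph_orderable Hint) as [P HP]; exists P; split; [trivial|].
  intros Q HQ; apply NNPP; intro HPQ; apply HB.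
  assert (Hcol : forall x y, holds P x y \/ holds Q x y ->
    agree P Q x y \/ clash P Q x y).
  { intros x y [H | H]; [apply (assoc_holds HP) in H | apply (assoc_holds HQ) in H];
      now apply (agree_or_clash HP HQ). }
  assert (HPa : forall x y, holds P x y -> ~ holds P y x)
    by (intros x y H; now apply (assoc_holds HP)).
  assert (HQa : forall x y, holds Q x y -> ~ holds Q y x)
    by (intros x y H; now apply (assoc_holds HQ)).
  assert (Hclash : exists a b, clash P Q a b).
  { apply NNPP; intro H; apply HPQ; left; intros x y.
    specialize (Hcol x y); specialize (HPa x y); specialize (HQa x y).
    assert (~ clash P Q x y) by eauto; unfold agree in Hcol; tauto. }
  assert (Hagree : exists c d, agree P Q c d).
  { apply NNPP; intro H; apply HPQ; right; intros x y.
    pose proof (Hcol y x); specialize (Hcol x y).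
    specialize (HPa y x); specialize (HQa x y).
    assert (~ agree P Q x y) by eauto; assert (~ agree P Q y x) by eauto.
    unfold clash in *; tauto. }
  destruct Hclash as (a & b & Hab), Hagree as (c & d & Hcd).
  (* If both ends of the clash were adjacent to both ends of the agreement, the four would form an
     induced 4-cycle. *)
  assert (Hmix : exists x y z, clash P Q x y /\ agree P Q x z).
  { destruct (clash_nonadj HE HP Hab) as (Ha & Hb & Hnab).
    destruct (agree_nonadj HE HP Hcd) as (Hc & Hd & Hncd).
    pose proof (clash_sym Hab) as Hba; pose proof (agree_sym Hcd) as Hdc.
    destruct (classic (holds E a c)) as [Hac | Hac];
      [|exact (mixed_vertex HE HP HQ Hab Hcd Hac)].
    destruct (classic (holds E a d)) as [Had | Had];
      [|exact (mixed_vertex HE HP HQ Hab Hdc Had)].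
    destruct (classic (holds E b c)) as [Hbc | Hbc];
      [|exact (mixed_vertex HE HP HQ Hba Hcd Hbc)].
    apply (mixed_vertex HE HP HQ Hba Hdc).
    exact (interval_graph_no_C4 Hint Ha Hb Hc Hd Hnab Hncd Hac Had Hbc). }
  destruct Hmix as (x & y & z & Hxy & Hxz).
  pose proof (clash_agree_nonadj HE HP HQ Hxy Hxz) as Hyz.
  destruct (clash_nonadj HE HP Hxy) as (_ & Hy & _).
  destruct (agree_nonadj HE HP Hxz) as (_ & Hz & _).
  destruct (agree_or_clash HP HQ Hy Hz Hyz) as [H | H].
  (* Here [z] agrees with both ends of the clash [x], [y]. *)
  - apply (clash_triangle_buried HE HP HQ (w := z) Hxy); now apply agree_sym.
  (* Here [y] clashes with both [x] and [z]. Dualizing [Q] exchanges clashes and agreements, so [y]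
     becomes the apex over [x], [z]. *)
  - destruct (dual_exists HQ) as (Q' & HQ' & Hdual).
    unfold dual_order in Hdual.
    apply (clash_triangle_buried HE HP HQ' (w := y) (u := x) (v := z));
      unfold agree, clash in *; rewrite !Hdual; tauto.
Qed.

End ACA.

(** ** The graph of the reversal *)

Lemma two_step_path (V E : sets M) u c v :
  u ∈ V -> c ∈ V -> v ∈ V -> holds E u c -> holds E c v ->
  exists X n, path V E X n u v.
Proof.
  intros Hu Hc Hv Huc Hcv.
  destruct (@bounded_comprehension (fOr (fEq #0 (tPair tZero #2))
    (fOr (fEq #0 (tPair tOne #3)) (fEq #0 (tPair (tAdd tOne tOne) #4))))
    (scons u (scons c (fun _ => v))) (fun _ => V)) as [X HX]; [solve_bounded|].
  change (forall z, z ∈ X <->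
    z = pair 0 u \/ z = pair 1 c \/ z = pair (1 + 1) v) in HX.
  assert (HX' : forall i x, holds X i x <->
    (i = 0 /\ x = u) \/ (i = 1 /\ x = c) \/ (i = 1 + 1 /\ x = v)).
  { intros i x; unfold holds; now rewrite HX, !pair_inj_iff. }
  pose proof one_neq0 as H10; pose proof two_neq0 as H20.
  pose proof two_neq1 as H21.
  exists X, (1 + 1); split; [split; [|split; [|split]]|split; [|split; [|split]]].
  - exists (pair 0 u + pair 1 c + pair (1 + 1) v + 1).
    intros z Hz; apply lt_exists; apply HX in Hz as [-> | [-> | ->]];
      eexists; [instantiate (1 := pair 1 c + pair (1 + 1) v)
      | instantiate (1 := pair 0 u + pair (1 + 1) v)
      | instantiate (1 := pair 0 u + pair 1 c)]; ring.
  - intros z [-> | [-> | ->]]%HX; eauto.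
  - intros i x y; rewrite !HX'.
    intros [[-> ->] | [[-> ->] | [-> ->]]] [[E1 ->] | [[E1 ->] | [E1 ->]]];
      congruence.
  - intro i; rewrite (lt_succ ax), (lt_succ ax).
    rewrite <- (add_0_l 1) at 1; rewrite (lt_succ ax); split.
    + intros [[[H%(not_lt_0 ax) | ->] | ->] | ->]; [easy | ..];
        eexists; rewrite HX'; eauto.
    + intros [x Hx]; apply HX' in Hx; tauto.
  - intros i x [[-> ->] | [[-> ->] | [-> ->]]]%HX'; trivial.
  - rewrite HX'; auto.
  - rewrite HX'; auto.
  - intros i x y Hi; rewrite !HX'.
    intros [[-> ->] | [[-> ->] | [-> ->]]].
    + rewrite add_0_l; intros [[E1 ->] | [[E1 ->] | [E1 ->]]]; congruence.
    + intros [[E1 ->] | [[E1 ->] | [E1 ->]]]; congruence.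
    + now apply lt_irrefl in Hi.
Qed.

Section Reversal.
Context (Z : sets M).

(** The tags 1 and 2 keep the left and right vertices apart from the root [0 = pair 0 0] and from
    [1 = pair 0 1]. *)
Definition lvert n : num M := pair 1 n.
Definition rvert n : num M := pair (1 + 1) n.
Definition leaf v : Prop := exists n, v = lvert n \/ v = rvert n.
(** [lr_edge] and [root_edge] are edges of the complement, oriented as in one of the associated
    orders. *)
Definition lr_edge u v : Prop :=
  exists n m, u = lvert n /\ v = rvert m /\ exists l, l < m /\ holds Z n l.
Definition root_edge u v : Prop := u = 0 /\ leaf v.
Definition fLvert (t n : term) : formula := fEq t (tPair tOne n).
Definition fRvert (t n : term) : formula := fEq t (tPair (tAdd tOne tOne) n).
Definition fRootEdge (u v : nat) : formula :=
  fAnd (fEq #u tZero)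
    (fExLt (tAdd #v tOne) (fOr (fLvert #(S v) #0) (fRvert #(S v) #0))).

Lemma leaf_bounded v :
  leaf v <-> exists n, n < v + 1 /\ (v = lvert n \/ v = rvert n).
Proof.
  split; [|intros (n & _ & H); now exists n].
  intros [n H]; exists n; split; [|trivial].
  destruct H as [-> | ->]; apply pair_le_r.
Qed.

Lemma zero_not_leaf : ~ leaf 0.
Proof.
  assert (H0 : @zero M = pair 0 0) by (unfold pair; ring).
  rewrite H0; intros [n [[H _]%pair_inj | [H _]%pair_inj]].
  - now apply one_neq0.
  - now apply two_neq0.
Qed.

Lemma one_not_leaf : ~ leaf 1.
Proof.
  assert (H1 : @one M = pair 0 1) by (unfold pair; ring).
  rewrite H1; intros [n [[H _]%pair_inj | [H _]%pair_inj]].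
  - now apply one_neq0.
  - now apply two_neq0.
Qed.

Lemma lvert_leaf n : leaf (lvert n).
Proof. exists n; auto. Qed.
Lemma rvert_leaf n : leaf (rvert n).
Proof. exists n; auto. Qed.

Lemma lvert_inj n m : lvert n = lvert m -> n = m.
Proof. now intros [_ H]%pair_inj. Qed.
Lemma rvert_inj n m : rvert n = rvert m -> n = m.
Proof. now intros [_ H]%pair_inj. Qed.
Lemma lvert_neq_rvert n m : lvert n <> rvert m.
Proof. intros [H _]%pair_inj; symmetry in H; now apply two_neq1 in H. Qed.

Lemma lr_edge_leaf u v : lr_edge u v -> leaf u /\ leaf v.
Proof. intros (n & m & -> & -> & _); auto using lvert_leaf, rvert_leaf. Qed.

Lemma lr_edge_not_path u v w : lr_edge u v -> ~ lr_edge v w.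
Proof.
  intros (n & m & -> & -> & _) (n' & m' & H & _).
  symmetry in H; now apply lvert_neq_rvert in H.
Qed.

Lemma lr_edge_iff n m :
  lr_edge (lvert n) (rvert m) <-> exists l, l < m /\ holds Z n l.
Proof.
  split; [|intro H; now exists n, m].
  now intros (n' & m' & <-%lvert_inj & <-%rvert_inj & H).
Qed.

Definition adjacent u v : Prop :=
  ~ root_edge u v /\ ~ root_edge v u /\ ~ lr_edge u v /\ ~ lr_edge v u.

Lemma lr_relation : exists T : sets M, forall u v, holds T u v <-> lr_edge u v.
Proof.
  destruct (@bounded_relation
    (fExLt (tAdd #1 tOne) (fExLt (tAdd #1 tOne)
      (fAnd (fLvert #3 #1) (fAnd (fRvert #2 #0) (fExLt #0 (fHolds 0 #2 #0))))))
    (fun _ => 0) (fun _ => Z)) as (T & _ & HT);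
    [unfold fLvert, fRvert; solve_bounded|].
  change (forall u v, holds T u v <-> exists n, n < u + 1 /\ exists m, m < v + 1 /\
    u = lvert n /\ v = rvert m /\ exists l, l < m /\ holds Z n l) in HT.
  exists T; intros u v; rewrite HT; split.
  - intros (n & _ & m & _ & H); now exists n, m.
  - intros (n & m & Hu & Hv & H); exists n; split; [rewrite Hu; apply pair_le_r|].
    exists m; split; [rewrite Hv; apply pair_le_r | auto].
Qed.

(** An interval representation over the natural order: the interval of [lvert n] ends at [l + 1] for
    the least [l] with [Z n l], or never. Deciding whether [x] belongs to it inspects only [l] with
    [l + 1 < x], so the definition is bounded. *)
Lemma interval_relation : exists F : sets M,
  (forall z, z ∈ F -> exists x y, z = pair x y) /\
  (forall x, holds F 0 x <-> x = 0) /\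
  (forall n x, holds F (lvert n) x <->
     0 < x /\ forall l, l + 1 < x -> ~ holds Z n l) /\
  (forall n x, holds F (rvert n) x <-> n < x) /\
  (forall v x, v <> 0 -> ~ leaf v -> holds F v x).
Proof.
  destruct (@bounded_relation
    (fAnd (fImp (fEq #1 tZero) (fEq #0 tZero)) (fAllLt (tAdd #1 tOne) (fAnd
      (fImp (fLvert #2 #0) (fAnd (fLt tZero #1)
        (fAllLt #1 (fImp (fLt (tAdd #0 tOne) #2) (fNot (fHolds 0 #1 #0))))))
      (fImp (fRvert #2 #0) (fLt #0 #1)))))
    (fun _ => 0) (fun _ => Z)) as (F & HFp & HF);
    [unfold fLvert, fRvert; solve_bounded|].
  change (forall v x, holds F v x <-> (v = 0 -> x = 0) /\ forall n, n < v + 1 ->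
    (v = lvert n -> 0 < x /\ forall l, l < x -> l + 1 < x -> ~ holds Z n l) /\
    (v = rvert n -> n < x)) in HF.
  exists F; split; [exact HFp | split; [|split; [|split]]].
  - intro x; rewrite HF; split; [now intros [H _]; apply H|].
    intros ->; split; [trivial|]; intros n _.
    split; intro H; destruct zero_not_leaf; exists n; auto.
  - intros n x; rewrite HF; split.
    + intros [_ H]; destruct (H n) as [[H0 Hl] _]; trivial; [apply pair_le_r|].
      split; trivial; intros l Hlx; apply Hl; trivial.
      apply lt_trans with (l + 1); trivial; apply (lt_succ ax); auto.
    + intros [H0 Hl]; split.
      * intro H; destruct zero_not_leaf; rewrite <- H; apply lvert_leaf.
      * intros m _; split; [|intro H; now apply lvert_neq_rvert in H].
        intros <-%lvert_inj; auto.
  - intros n x; rewrite HF; split.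
    + intros [_ H]; apply (H n); trivial; apply pair_le_r.
    + intro H; split.
      * intro E; destruct zero_not_leaf; rewrite <- E; apply rvert_leaf.
      * intros m _; split; [intro E; symmetry in E; now apply lvert_neq_rvert in E|].
        now intros <-%rvert_inj.
  - intros v x Hv Hl; apply HF; split; [contradiction|].
    intros n _; split; intro H; destruct Hl; exists n; auto.
Qed.

Lemma vertex_cases v :
  v = 0 \/ (exists n, v = lvert n) \/ (exists n, v = rvert n) \/ (v <> 0 /\ ~ leaf v).
Proof.
  destruct (classic (v = 0)) as [|Hv]; [now left|].
  destruct (classic (leaf v)) as [[n [H | H]]|]; eauto.
Qed.

Lemma adjacent_sym u v : adjacent u v -> adjacent v u.
Proof. unfold adjacent; tauto. Qed.

Lemma adjacent_leaves u v : leaf u -> leaf v ->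
  ~ lr_edge u v -> ~ lr_edge v u -> adjacent u v.
Proof.
  intros Hu Hv H1 H2; split; [|split; [|now split]];
    intros [-> _]; now apply zero_not_leaf.
Qed.

Lemma adjacent_universal u v : u <> 0 -> ~ leaf u -> adjacent u v.
Proof.
  intros Hu Hl; unfold adjacent, root_edge.
  split; [tauto | split; [tauto | split]]; intros []%lr_edge_leaf; tauto.
Qed.

(** * Properties of the reversal graph *)

Section ReversalGraph.
Context (V E : sets M) (HV : forall v, v ∈ V)
  (HEp : forall z, z ∈ E -> exists x y, z = pair x y)
  (HE : forall u v, holds E u v <-> adjacent u v).

Lemma sub_prod_full (R : sets M) :
  (forall z, z ∈ R -> exists x y, z = pair x y) -> sub_prod R V V.
Proof. intro H; apply sub_prod_intro; auto. Qed.

Lemma reversal_graph : graph V E.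
Proof.
  split; [now apply sub_prod_full|].
  intros u v; rewrite !HE; apply adjacent_sym.
Qed.

Lemma reversal_interval : interval_graph V E.
Proof.
  split; [exact reversal_graph|].
  destruct interval_relation as (F & HFp & HF0 & HFl & HFr & HF1).
  destruct (@bounded_relation (fLt #1 #0) (fun _ => 0) (fun _ => Z))
    as (R & HRp & HR); [solve_bounded|].
  change (forall x y, holds R x y <-> x < y) in HR.
  assert (HF0leaf : forall v x, leaf v -> holds F v x -> 0 < x).
  { intros v x [n [-> | ->]] H.
    - now apply HFl in H.
    - apply HFr in H; destruct (zero_or_pos n) as [<- | Hn]; trivial.
      now apply lt_trans with n. }
  assert (Hdisj : forall u v x, root_edge u v \/ lr_edge u v ->
    holds F u x -> ~ holds F v x).
  { intros u v x [[-> Hv] | (n & m & -> & -> & l & Hl & HZ)] Hu Hv'.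
    - apply HF0 in Hu; subst x; apply (lt_irrefl (HF0leaf _ _ Hv Hv')).
    - apply HFl in Hu as [_ Hu]; apply HFr in Hv'; apply (Hu l); trivial.
      apply lt_add_1 in Hl; apply lt_add_1 in Hv'.
      destruct (proj1 (lt_succ ax _ _) Hv') as [H | <-]; trivial.
      now apply lt_trans with (m + 1). }
  (* All left intervals share the point 1, as no [l] satisfies [l + 1 < 1]. *)
  assert (HFl1 : forall n, holds F (lvert n) 1).
  { intro n; apply HFl; split; [rewrite <- (add_0_l 1); apply lt_0_succ|].
    intros l H; assert (H' : l + 1 < 0 + 1) by now rewrite add_0_l.
    apply (proj1 (lt_add_1 _ _)) in H'; now apply (not_lt_0 ax) in H'. }
  (* The witness [m + 1] is the first point of the interval of [rvert m]. *)
  assert (HFlr : forall n m, ~ lr_edge (lvert n) (rvert m) ->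
    exists x, holds F (lvert n) x /\ holds F (rvert m) x).
  { intros n m H; exists (m + 1); split; [apply HFl; split|].
    - apply lt_0_succ.
    - intros l Hl%(proj1 (lt_add_1 _ _)) HZ; apply H, lr_edge_iff; eauto.
    - apply HFr, (lt_succ ax); auto. }
  exists V, R, F; split; [split; [split; [|split]|]|split; [|split; [|split]]].
  - now apply sub_prod_full.
  - intros x H%HR; now apply lt_irrefl in H.
  - intros x y z; rewrite !HR; apply lt_trans.
  - intros x y _ _; rewrite !HR; apply lt_trichotomy.
  - now apply sub_prod_full.
  - intros p _; destruct (vertex_cases p) as [-> | [[n ->] | [[n ->] | [H0 H1]]]].
    + exists 0; now apply HF0.
    + eauto.
    + exists (n + 1); apply HFr, (lt_succ ax); auto.
    + exists 0; auto.
  - intros p x y z _ Hx Hy _; rewrite !HR; intros Hxz Hzy.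
    destruct (vertex_cases p) as [-> | [[n ->] | [[n ->] | [H0 H1]]]].
    + apply HF0 in Hy; subst y; now apply (not_lt_0 ax) in Hzy.
    + apply HFl in Hx as [Hx _], Hy as [_ Hy]; apply HFl; split.
      * now apply lt_trans with x.
      * intros l Hl; apply Hy; now apply lt_trans with z.
    + apply HFr in Hx; apply HFr; now apply lt_trans with x.
    + auto.
  - intros p q _ _; rewrite HE; split.
    + intros (H1 & H2 & H3 & H4); unfold root_edge in H1, H2.
      assert (Hleaf : forall v, ~ leaf v -> holds F v 0).
      { intros v Hv; destruct (classic (v = 0)) as [-> | ?]; [now apply HF0 | auto]. }
      destruct (vertex_cases p) as [-> | [[n ->] | [[n ->] | [Hp Hp']]]];
        [exists 0; split; apply Hleaf; [apply zero_not_leaf | tauto] | ..];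
      (destruct (vertex_cases q) as [-> | [[m ->] | [[m ->] | [Hq Hq']]]];
        [exists 0; split; apply Hleaf; [tauto | apply zero_not_leaf] | ..]).
      * exists 1; auto.
      * auto.
      * exists 1; auto.
      * destruct (HFlr m n) as (x & Hx & Hx'); eauto.
      * exists (n + m + 1); rewrite !HFr; split; [apply lt_add|].
        rewrite (add_comm n); apply lt_add.
      * exists (n + 1); split; [apply HFr, (lt_succ ax) | ]; auto.
      * exists 1; auto.
      * exists (m + 1); split; [|apply HFr, (lt_succ ax)]; auto.
      * exists 0; auto.
    + intros (x & Hp & Hq).
      pose proof (fun H => Hdisj p q x H Hp Hq).
      pose proof (fun H => Hdisj q p x H Hq Hp).
      unfold adjacent; tauto.
Qed.

Lemma reversal_connected : connected V E.
Proof.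
  assert (H1 : forall v, adjacent v 1).
  { intro v; apply adjacent_sym, adjacent_universal;
      [apply one_neq0 | apply one_not_leaf]. }
  intros u v _ _; apply two_step_path with 1; auto; apply HE; auto.
  now apply adjacent_sym.
Qed.

(* The hypotheses on [T] are met by the relation [lr_edge] and by its dual. *)
Lemma layered_order (T : num M -> num M -> Prop) (P : sets M) :
  (forall z, z ∈ P -> exists x y, z = pair x y) ->
  (forall u v, holds P u v <-> root_edge u v \/ T u v) ->
  (forall u v, T u v -> leaf u /\ leaf v) ->
  (forall u v w, T u v -> ~ T v w) ->
  (forall u v, T u v \/ T v u <-> lr_edge u v \/ lr_edge v u) ->
  associated_order V E P.
Proof.
  intros HPp HP HTl HTn HT; split; [split; [|split]|].
  - now apply sub_prod_full.
  - intros x [[-> H] | H]%HP; [now apply zero_not_leaf | exact (HTn _ _ _ H H)].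
  - intros x y z Hxy Hyz; apply HP in Hxy, Hyz; apply HP.
    destruct Hyz as [[-> H] | H].
    + destruct Hxy as [[_ H'] | [_ H']%HTl]; now apply zero_not_leaf in H'.
    + destruct Hxy as [[-> _] | H']; [|now destruct (HTn _ _ _ H' H)].
      left; split; [trivial | now apply HTl in H].
  - intros u v _ _; rewrite HE, !HP; specialize (HT u v).
    unfold adjacent; split; [|tauto].
    intro H; apply NNPP; intro H'; apply H; tauto.
Qed.

(** [P] and [Q] agree on the root and [lvert n] but differ on [lvert n] and [rvert (l + 1)], so they
    cannot both be [O] or its dual. *)
Lemma reversal_not_unique n l : holds Z n l -> ~ uniquely_orderable V E.
Proof.
  intros HZ (O & _ & Huniq).
  destruct lr_relation as [T HT].
  destruct (@bounded_relation (fOr (fRootEdge 1 0) (fHolds 0 #1 #0))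
    (fun _ => 0) (fun _ => T)) as (P & HPp & HP);
    [unfold fRootEdge, fLvert, fRvert; solve_bounded|].
  destruct (@bounded_relation (fOr (fRootEdge 1 0) (fHolds 0 #0 #1))
    (fun _ => 0) (fun _ => T)) as (Q & HQp & HQ);
    [unfold fRootEdge, fLvert, fRvert; solve_bounded|].
  assert (HP' : forall u v, holds P u v <-> root_edge u v \/ lr_edge u v).
  { intros u v; rewrite HP; unfold root_edge; rewrite leaf_bounded, <- HT.
    reflexivity. }
  assert (HQ' : forall u v, holds Q u v <-> root_edge u v \/ lr_edge v u).
  { intros u v; rewrite HQ; unfold root_edge; rewrite leaf_bounded, <- HT.
    reflexivity. }
  clear HP HQ.
  assert (HPa : associated_order V E P).
  { apply (layered_order (T := lr_edge)); auto.
    - apply lr_edge_leaf.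
    - apply lr_edge_not_path.
    - intros; tauto. }
  assert (HQa : associated_order V E Q).
  { apply (layered_order (T := fun u v => lr_edge v u)); auto.
    - intros u v [H1 H2]%lr_edge_leaf; auto.
    - intros u v w H H'; exact (lr_edge_not_path H' H).
    - intros; tauto. }
  assert (Hlr : lr_edge (lvert n) (rvert (l + 1)))
    by (apply lr_edge_iff; exists l; rewrite (lt_succ ax); auto).
  assert (H0 : holds P 0 (lvert n)) by (apply HP'; left; split; auto using lvert_leaf).
  assert (H1 : holds Q 0 (lvert n)) by (apply HQ'; left; split; auto using lvert_leaf).
  assert (H2 : holds P (lvert n) (rvert (l + 1))) by (apply HP'; auto).
  assert (H3 : holds Q (rvert (l + 1)) (lvert n)) by (apply HQ'; auto).
  pose proof (assoc_holds HPa H0) as (_ & _ & _ & N0).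
  pose proof (assoc_holds HQa H1) as (_ & _ & _ & N1).
  pose proof (assoc_holds HPa H2) as (_ & _ & _ & N2).
  pose proof (assoc_holds HQa H3) as (_ & _ & _ & N3).
  unfold same_order, dual_order in Huniq.
  destruct (Huniq P HPa) as [HOP | HOP], (Huniq Q HQa) as [HOQ | HOQ];
    rewrite ?HOP, ?HOQ in *; contradiction.
Qed.

Lemma buried_decides (B : sets M) n :
  buried_subgraph V E B -> lvert n ∈ B <-> exists l, holds Z n l.
Proof.
  intros (_ & (a & b & Ha & Hb & Hab) & (HK & r & _ & Hr) & HBR).
  (* A vertex that distinguishes two elements of [B] is neither in K(B) nor in R(B). *)
  assert (Hin : forall v b1 b2, b1 ∈ B -> b2 ∈ B -> holds E v b1 -> ~ holds E v b2 ->
    v ∈ B).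
  { intros v b1 b2 H1 H2 E1 E2; apply NNPP; intro Hv.
    apply (HBR b1 v); trivial; [|now apply HE, adjacent_sym, HE].
    split; trivial; intros [H | [_ H]]; auto. }
  assert (Hll : forall i j, holds E (lvert i) (lvert j)).
  { intros i j; apply HE, adjacent_leaves; auto using lvert_leaf;
      intros (n' & m' & _ & H & _); now apply lvert_neq_rvert in H. }
  assert (Hrr : forall i j, holds E (rvert i) (rvert j)).
  { intros i j; apply HE, adjacent_leaves; auto using rvert_leaf;
      intros (n' & m' & H & _); symmetry in H; now apply lvert_neq_rvert in H. }
  assert (Hlr : forall i j, ~ holds E (lvert i) (rvert j) <->
    exists l, l < j /\ holds Z i l).
  { intros i j; rewrite <- lr_edge_iff, HE; split; [|unfold adjacent; tauto].
    intro H; apply NNPP; intro H'; apply H, adjacent_leaves;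
      auto using lvert_leaf, rvert_leaf.
    intros (n' & m' & E0 & _); symmetry in E0; now apply lvert_neq_rvert in E0. }
  assert (H0leaf : forall v, leaf v -> ~ holds E v 0)
    by (intros v Hv [_ [H _]]%HE; apply H; now split).
  assert (Huniv : forall v, v <> 0 -> ~ leaf v -> forall u, holds E v u)
    by (intros v Hv Hv' u; now apply HE, adjacent_universal).
  assert (HBuniv : forall v, v ∈ B -> v = 0 \/ leaf v).
  { intros v Hv; apply NNPP; intro H; apply HK; exists v; split; trivial.
    split; trivial; intros u _; apply Huniv; tauto. }
  assert (H00 : holds E 0 0).
  { apply HE; unfold adjacent, root_edge; pose proof zero_not_leaf.
    split; [tauto | split; [tauto | split]]; intros []%lr_edge_leaf; tauto. }
  (* Were the root in [B], some leaf would be too. Then [rvert 0], adjacent to every leaf but not to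
     the root, enters [B] by [Hin], and after it every leaf, which leaves R(B) empty. *)
  assert (H0B : ~ 0 ∈ B).
  { intro H0.
    assert (Hd : exists d, d ∈ B /\ leaf d).
    { destruct (HBuniv a Ha) as [-> |]; [|now exists a].
      destruct (HBuniv b Hb) as [-> |]; [contradiction | now exists b]. }
    destruct Hd as (d & HdB & Hd).
    assert (Hr0 : forall v, leaf v -> holds E v (rvert 0)).
    { intros v [i [-> | ->]]; [|apply Hrr]; apply NNPP.
      now intros (l & H%(not_lt_0 ax) & _)%Hlr. }
    assert (Hr0B : rvert 0 ∈ B).
    { apply Hin with d 0; trivial; [|apply H0leaf, rvert_leaf].
      now apply HE, adjacent_sym, HE, Hr0. }
    assert (HlB : forall v, leaf v -> v ∈ B)
      by (intros v Hv; apply Hin with (rvert 0) 0; auto).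
    apply Hr; destruct (classic (r = 0)) as [-> |]; [now left|].
    destruct (classic (leaf r)); [left; auto|].
    right; split; trivial; intros u _; now apply Huniv. }
  assert (HBleaf : forall v, v ∈ B -> leaf v)
    by (intros v Hv; destruct (HBuniv v Hv) as [-> |]; [contradiction | trivial]).
  split.
  (* Without any [Z n l], [lvert n] is adjacent to all leaves and would lie in both [B] and K(B). *)
  - intro Hn; apply NNPP; intro HnZ; apply HK; exists (lvert n); split; trivial.
    split; trivial; intros v Hv.
    destruct (HBleaf v Hv) as [i [-> | ->]]; [apply Hll|].
    apply NNPP; intros (l & _ & H)%Hlr; apply HnZ; now exists l.
  - intros [l Hl].
    assert (Hedge : exists i j, lvert i ∈ B /\ rvert j ∈ B /\
      ~ holds E (lvert i) (rvert j)).
    { destruct (HBleaf a Ha) as [i [-> | ->]], (HBleaf b Hb) as [j [-> | ->]].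
      - now destruct Hab.
      - eauto.
      - exists j, i; split; [|split]; trivial.
        intro H; now apply Hab, HE, adjacent_sym, HE.
      - now destruct Hab. }
    destruct Hedge as (i & j & Hi & Hj & (l' & Hl' & HZ')%Hlr).
    (* [t] exceeds [j] and [l]: the first puts [rvert t] into [B], the second makes [lvert n]
       nonadjacent to it. *)
    set (t := l + j + 1).
    assert (Ht : rvert t ∈ B).
    { apply Hin with (rvert j) (lvert i); auto.
      intro H; apply HE, adjacent_sym, HE in H; revert H; apply Hlr.
      exists l'; split; trivial; apply lt_trans with j; trivial.
      unfold t; rewrite (add_comm l); apply lt_add. }
    apply Hin with (lvert i) (rvert t); auto.
    apply Hlr; exists l; split; trivial; apply lt_add.
Qed.

End ReversalGraph.

Lemma projection_exists : unique_orderability_characterization M ->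
  exists A, forall n, n ∈ A <-> exists l, holds Z n l.
Proof.
  intro hC.
  (* An empty [Z] is treated apart, since [reversal_not_unique] starts from one pair in [Z]. *)
  destruct (classic (exists n l, holds Z n l)) as [(n0 & l0 & H0) | Hempty].
  2:{ destruct (@bounded_comprehension (fNot (fEq #0 #0)) (fun _ => 0) (fun _ => Z))
        as [A HA]; [solve_bounded|].
      exists A; intro n; rewrite HA; simpl; split; [easy|].
      intros [l H] _; eauto. }
  destruct (@bounded_comprehension (fEq #0 #0) (fun _ => 0) (fun _ => Z))
    as [V HV]; [solve_bounded|].
  assert (HV' : forall v, v ∈ V) by (intro v; now apply HV).
  destruct lr_relation as [T HT].
  destruct (@bounded_relation
    (fAnd (fNot (fRootEdge 1 0)) (fAnd (fNot (fRootEdge 0 1))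
      (fAnd (fNot (fHolds 0 #1 #0)) (fNot (fHolds 0 #0 #1)))))
    (fun _ => 0) (fun _ => T)) as (E & HEp & HE);
    [unfold fRootEdge, fLvert, fRvert; solve_bounded|].
  assert (HE' : forall u v, holds E u v <-> adjacent u v).
  { intros u v; rewrite HE; unfold adjacent, root_edge.
    rewrite !leaf_bounded, <- !HT; reflexivity. }
  destruct (classic (exists B, buried_subgraph V E B)) as [[B HB] | HB].
  - destruct (@bounded_comprehension (fMem (tPair tOne #0) 0) (fun _ => 0)
      (fun _ => B)) as [A HA]; [solve_bounded|].
    change (forall n, n ∈ A <-> lvert n ∈ B) in HA.
    exists A; intro n; rewrite HA; now apply (buried_decides (V := V) (E := E)).
  - apply hC in HB; [|now apply reversal_connected | now apply reversal_interval].
    now apply (reversal_not_unique HV' HE' H0) in HB.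
Qed.

End Reversal.

(** ** Arithmetical comprehension from projections *)

Section Projections.
Context (hproj : forall Z : sets M,
  exists A, forall n, n ∈ A <-> exists l, holds Z n l).

(** The first [k] variables of an environment packed into one number; [k] is a standard natural
    number because it bounds the variables of an actual formula. *)
Fixpoint tuple (k : nat) (a : nat -> num M) : num M :=
  match k with O => 0 | S k => pair (a O) (tuple k (fun i : nat => a (S i))) end.

(** The values [y1] and [y2] are put below a common bound [m], so a single projection along [m]
    removes both. *)
Lemma join_graphs (G1 G2 Y : sets M) p (R : num M -> num M -> num M -> Prop) :
  bounded p ->
  (forall y1 y2 y r e, sat (scons y2 (scons y1 (scons r (scons y e))))
     (scons G1 (scons G2 (fun _ => Y))) p <-> R y1 y2 y) ->
  exists G, forall y r, holds G y r <->
    exists y1 y2, holds G1 y1 r /\ holds G2 y2 r /\ R y1 y2 y.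
Proof.
  intros Hp HR.
  destruct (@bounded_relation
    (fExLt (tAdd #1 tOne) (fExLt (tAdd #2 tOne) (fAnd (fEq #3 (tPair #1 #0))
      (fExLt #2 (fExLt #3
        (fAnd (fHolds 0 #1 #2) (fAnd (fHolds 1 #0 #2) p)))))))
    (fun _ => 0) (scons G1 (scons G2 (fun _ => Y)))) as (Z & _ & HZ);
    [solve_bounded; exact Hp|].
  destruct (hproj Z) as [G HG]; exists G; intros y r; unfold holds at 1; rewrite HG.
  split.
  - intros [m Hm]; apply HZ in Hm.
    destruct Hm as (y' & _ & r' & _ & E & y1 & _ & y2 & _ & H1 & H2 & H3).
    change (pair y r = pair y' r') in E; apply pair_inj in E as [<- <-].
    apply HR in H3; now exists y1, y2.
  - intros (y1 & y2 & H1 & H2 & H3); exists (y1 + y2 + 1); apply HZ.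
    exists y; split; [apply pair_le_l|]; exists r; split; [apply pair_le_r|].
    split; [reflexivity|].
    exists y1; split; [apply lt_add|].
    exists y2; split; [simpl; rewrite (add_comm y1); apply lt_add|].
    split; [exact H1 | split; [exact H2 | now apply HR]].
Qed.

Lemma variable_graph : forall n k : nat, (n < k)%nat -> exists G : sets M,
  forall y a, holds G y (tuple k a) <-> y = a n.
Proof.
  destruct (sets_inhabited M) as [X0].
  induction n as [|n IH]; intros [|k] Hk; try lia.
  - destruct (@bounded_relation (fExLt (tAdd #0 tOne) (fEq #1 (tPair #2 #0)))
      (fun _ => 0) (fun _ => X0)) as (G & _ & HG); [solve_bounded|].
    change (forall y t, holds G y t <-> exists r, r < t + 1 /\ t = pair y r) in HG.
    exists G; intros y a; rewrite HG; cbn [tuple]; split.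
    + now intros (r & _ & [E _]%pair_inj).
    + intros ->; eexists; split; [apply pair_le_r | reflexivity].
  - destruct (IH k) as [G' HG']; [lia|].
    destruct (@bounded_relation (fExLt (tAdd #0 tOne) (fExLt (tAdd #1 tOne)
      (fAnd (fEq #2 (tPair #1 #0)) (fHolds 0 #3 #0))))
      (fun _ => 0) (fun _ => G')) as (G & _ & HG); [solve_bounded|].
    change (forall y t, holds G y t <-> exists x, x < t + 1 /\ exists r, r < t + 1 /\
      t = pair x r /\ holds G' y r) in HG.
    exists G; intros y a; rewrite HG, <- (HG' y (fun i : nat => a (S i))).
    cbn [tuple]; split.
    + now intros (x & _ & r & _ & [_ <-]%pair_inj & H).
    + intro H; exists (a O); split; [apply pair_le_l|].
      eexists; split; [apply pair_le_r|]; split; [reflexivity | exact H].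
Qed.

Lemma term_graph (t : term) : exists k0 : nat, forall k : nat, (k0 <= k)%nat ->
  exists G : sets M,
  forall y a, holds G y (tuple k a) <-> y = eval a t.
Proof.
  destruct (sets_inhabited M) as [X0].
  induction t as [n | | | t [k1 IH1] u [k2 IH2] | t [k1 IH1] u [k2 IH2]].
  - exists (S n); intros k Hk; now apply variable_graph.
  - exists O; intros k _.
    destruct (@bounded_relation (fEq #1 tZero) (fun _ => 0) (fun _ => X0))
      as (G & _ & HG); [solve_bounded|].
    exists G; intros y a; apply HG.
  - exists O; intros k _.
    destruct (@bounded_relation (fEq #1 tOne) (fun _ => 0) (fun _ => X0))
      as (G & _ & HG); [solve_bounded|].
    exists G; intros y a; apply HG.
  - exists ((k1 + k2)%nat); intros k Hk.
    destruct (IH1 k) as [G1 HG1]; [lia|]; destruct (IH2 k) as [G2 HG2]; [lia|].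
    destruct (@join_graphs G1 G2 X0 (fEq #3 (tAdd #1 #0))
      (fun y1 y2 y => y = y1 + y2)) as [G HG]; [solve_bounded | now intros |].
    exists G; intros y a; rewrite HG; split.
    + now intros (y1 & y2 & ->%HG1 & ->%HG2 & H).
    + intro H; exists (eval a t), (eval a u); now rewrite HG1, HG2.
  - exists ((k1 + k2)%nat); intros k Hk.
    destruct (IH1 k) as [G1 HG1]; [lia|]; destruct (IH2 k) as [G2 HG2]; [lia|].
    destruct (@join_graphs G1 G2 X0 (fEq #3 (tMul #1 #0))
      (fun y1 y2 y => y = y1 * y2)) as [G HG]; [solve_bounded | now intros |].
    exists G; intros y a; rewrite HG; split.
    + now intros (y1 & y2 & ->%HG1 & ->%HG2 & H).
    + intro H; exists (eval a t), (eval a u); now rewrite HG1, HG2.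
Qed.

(** Allowing every large [k] lets two relations be brought to a common tuple length. *)
Definition representable (R : (nat -> num M) -> Prop) : Prop :=
  exists k0 : nat, forall k : nat, (k0 <= k)%nat -> exists X : sets M,
    forall a, tuple k a ∈ X <-> R a.

Lemma representable_atom (t u : term) (Y : sets M) p (R : num M -> num M -> Prop) :
  bounded p ->
  (forall y1 y2 e (G1 G2 : sets M), sat (scons y2 (scons y1 e))
     (scons G1 (scons G2 (fun _ => Y))) p <-> R y1 y2) ->
  representable (fun a => R (eval a t) (eval a u)).
Proof.
  intros Hp HR.
  destruct (term_graph t) as [k1 H1], (term_graph u) as [k2 H2].
  exists ((k1 + k2)%nat); intros k Hk.
  destruct (H1 k) as [G1 HG1]; [lia|]; destruct (H2 k) as [G2 HG2]; [lia|].
  destruct (@join_graphs G1 G2 Y p (fun y1 y2 _ => R y1 y2)) as [G HG];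
    [trivial | now intros; apply HR |].
  (* The relation ignores [y], so the slice of [G] at 0 is taken. *)
  destruct (@bounded_comprehension (fHolds 0 tZero #0) (fun _ => 0) (fun _ => G))
    as [X HX]; [solve_bounded|].
  change (forall r, r ∈ X <-> holds G 0 r) in HX.
  exists X; intro a; rewrite HX, HG; split.
  - now intros (y1 & y2 & ->%HG1 & ->%HG2 & H).
  - intro H; exists (eval a t), (eval a u); now rewrite HG1, HG2.
Qed.

Lemma representable_not R : representable R -> representable (fun a => ~ R a).
Proof.
  intros [k0 H]; exists k0; intros k Hk; destruct (H k Hk) as [X HX].
  destruct (@bounded_comprehension (fNot (fMem #0 0)) (fun _ => 0) (fun _ => X))
    as [Y HY]; [solve_bounded|].
  exists Y; intro a; rewrite HY; simpl; now rewrite HX.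
Qed.

Lemma representable_and R S : representable R -> representable S ->
  representable (fun a => R a /\ S a).
Proof.
  intros [k1 H1] [k2 H2]; exists ((k1 + k2)%nat); intros k Hk.
  destruct (H1 k) as [X HX]; [lia|]; destruct (H2 k) as [Y HY]; [lia|].
  destruct (@bounded_comprehension (fAnd (fMem #0 0) (fMem #0 1)) (fun _ => 0)
    (scons X (fun _ => Y))) as [A HA]; [solve_bounded|].
  exists A; intro a; rewrite HA; simpl; now rewrite HX, HY.
Qed.

(** The quantified variable is the head of a tuple of length [S k], so quantifying over it is a
    projection. *)
Lemma representable_ex R :
  representable R -> representable (fun a => exists x, R (scons x a)).
Proof.
  intros [k0 H]; exists k0; intros k Hk.
  destruct (H (S k)) as [X HX]; [lia|].
  destruct (@bounded_relation (fHolds 0 #0 #1) (fun _ => 0) (fun _ => X))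
    as (Z & _ & HZ); [solve_bounded|].
  change (forall r x, holds Z r x <-> pair x r ∈ X) in HZ.
  destruct (hproj Z) as [A HA]; exists A; intro a; rewrite HA.
  split; intros [x Hx]; exists x.
  - apply HZ in Hx; exact (proj1 (HX (scons x a)) Hx).
  - apply HZ; exact (proj2 (HX (scons x a)) Hx).
Qed.

Lemma representable_iff R S :
  (forall a, R a <-> S a) -> representable R -> representable S.
Proof.
  intros HRS [k0 H]; exists k0; intros k Hk; destruct (H k Hk) as [X HX].
  exists X; intro a; now rewrite HX.
Qed.

Lemma arithmetical_representable p s :
  arithmetical p -> representable (fun a => sat a s p).
Proof.
  induction p as [t u | t u | t X | p IH | p IHp q IHq | p IHp q IHq | p IHp q IHq
    | p IH | p IH | p IH | p IH]; simpl; intro Hp; try easy.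
  - now apply (@representable_atom t u (s O) (fEq #1 #0) eq); [solve_bounded|].
  - now apply (@representable_atom t u (s O) (fLt #1 #0) lt); [solve_bounded|].
  - now apply (@representable_atom t t (s X) (fMem #1 2) (fun y _ => y ∈ s X));
      [solve_bounded|].
  - now apply representable_not, IH.
  - now apply representable_and; [apply IHp | apply IHq].
  - apply representable_iff with (fun a => ~ (~ sat a s p /\ ~ sat a s q));
      [intro; tauto|].
    apply representable_not, representable_and; apply representable_not;
      [now apply IHp | now apply IHq].
  - apply representable_iff with (fun a => ~ (sat a s p /\ ~ sat a s q));
      [intro; tauto|].
    apply representable_not, representable_and; [now apply IHp|].
    now apply representable_not, IHq.
  - apply representable_iff with (fun a => ~ exists x, ~ sat (scons x a) s p).
    { intro a; split; [|intros H [x Hx]; auto].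
      intros H x; apply NNPP; eauto. }
    now apply representable_not, (@representable_ex (fun a => ~ sat a s p)),
      representable_not, IH.
  - now apply (@representable_ex (fun a => sat a s p)), IH.
Qed.

End Projections.

Lemma arithmetical_comprehension_from_projections :
  (forall Z : sets M, exists A, forall n, n ∈ A <-> exists l, holds Z n l) ->
  arithmetical_comprehension M.
Proof.
  intros hproj p e s Hp.
  destruct (arithmetical_representable hproj s Hp) as [k HX].
  (* The extra place holds the comprehension variable; the parameters enter as the single number
     [tuple k e]. *)
  destruct (HX (S k)) as [X HX']; [lia|].
  destruct (@bounded_comprehension (fMem (tPair #0 #2) 0)
    (fun _ => tuple k e) (fun _ => X)) as [A HA]; [solve_bounded|].
  exists A; intro n; rewrite HA; exact (HX' (scons n e)).
Qed.

End Model.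

Theorem theorem2 (M : l2_structure) (hM : models_RCA0 M) :
  models_ACA0 M <-> unique_orderability_characterization M.
Proof.
  split.
  - intros (_ & _ & hA) V E _ Hint; split.
    + apply (buried_not_unique hM), Hint.
    + now apply (unique_if_not_buried hM hA).
  - intro hC; split; [exact (proj1 hM) | split].
    + intro X; apply (set_ind_RCA hM).
    + apply (arithmetical_comprehension_from_projections hM).
      intro Z; exact (projection_exists hM Z hC).
Qed.
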